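(* Let $\Sigma=(A,B,C,\mathbf G)$ be a system node on $(U,X,Y)$ such that: (i) (essentially skew-adjoint and dissipative) $\mathcal D(A)=\mathcal D(A^* )$ and there exists $Q\in\mathcal L(X)$ with $Q\ge0$ such that $Ax+A^*x=-Qx$ for all $x\in\mathcal D(A)$; (ii) (colocated) $Y=U$ and $C=B^*$. For $s\in\rho(A)$ define $$E=-\tfrac12[\mathbf G(s)+\mathbf G(s)^*]+\tfrac12 B^*(\bar sI-A^* )^{-1}\left[2(\mathrm{Re}\,s)I+Q\right](sI-A)^{-1}B .$$ Then $E$ is independent of $s\in\rho(A)$, and the system node $\Sigma_E$ with generating triple $(A,B,B^* )$ and transfer function $\mathbf G_E=\mathbf G+E$ is impedance passive. Moreover, $E$ is the smallest self-adjoint operator in $\mathcal L(U)$ which has this passivity property.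
   Context: Spaces. $U,X,Y$ are complex Hilbert spaces. If $A:\mathcal D(A)\to X$ generates a strongly continuous semigroup on $X$ and $\alpha\in\rho(A)$, then $X_1$ is $\mathcal D(A)$ with the norm $\|(\alpha I-A)x\|$, and $X_{-1}$ is the completion of $X$ with respect to the norm $\|(\alpha I-A)^{-1}x\|$. The operator $A$ extends uniquely to an operator in $\mathcal L(X,X_{-1})$, and $(sI-A)^{-1}$ extends to an operator in $\mathcal L(X_{-1},X)$ for $s\in\rho(A)$. System node. A system node on $(U,X,Y)$ is $\Sigma=(A,B,C,\mathbf G)$, where $A$ generates a strongly continuous semigroup on $X$, $B\in\mathcal L(U,X_{-1})$, $C\in\mathcal L(X_1,Y)$ and $\mathbf G:\rho(A)\to\mathcal L(U,Y)$ satisfies $\mathbf G(s)-\mathbf G(\beta)=C[(sI-A)^{-1}-(\beta I-A)^{-1}]B$ for all $s,\beta\in\rho(A)$. $(A,B,C)$ is the generating triple, $\mathbf G$ the transfer function. The adjoint of $B$ is regarded as $B^*:\mathcal D(A^* )\to U$ ($X_{-1}$ is the dual of $\mathcal D(A^* )$ with respect to the pivot space $X$). Trajectories. $\mathcal D_0$ is the set of pairs $(z_0,u)\in X\times C^2([0,\infty),U)$ with $Az_0+Bu(0)\in X$. For $(z_0,u)\in\mathcal D_0$ the equation $\dot z=Az+Bu$, $z(0)=z_0$, has a unique solution $z\in C^1([0,\infty),X)$ (the state trajectory), and the output function is the continuous function $y(t)=C[z(t)-(\beta I-A)^{-1}Bu(t)]+\mathbf G(\beta)u(t)$, independent of $\beta\in\rho(A)$.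 Impedance passivity. A system node with $Y=U$ is impedance passive if for all $(z_0,u)\in\mathcal D_0$ and all $\tau>0$, $\|z(\tau)\|^2-\|z_0\|^2\le2\int_0^\tau\mathrm{Re}\,\langle u(t),y(t)\rangle\,dt$. ''Smallest'' refers to the usual order of self-adjoint operators: if $F=F^*\in\mathcal L(U)$ and the system node with generating triple $(A,B,B^* )$ and transfer function $\mathbf G+F$ is impedance passive, then $E\le F$. *)

(* Defs.v *)
From HB Require Import structures.
From mathcomp Require Import all_boot all_order all_algebra.
From mathcomp Require Import sesquilinear complex.
From mathcomp Require Import all_classical all_reals all_analysis.

Set Implicit Arguments.
Unset Strict Implicit.
Unset Printing Implicit Defensive.

Import Order.TTheory GRing.Theory Num.Theory.
Import numFieldNormedType.Exports.

Local Open Scope classical_set_scope.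
Local Open Scope ring_scope.
Local Open Scope complex_scope.

(** Complex Hilbert spaces.  The inner product is linear in its first argument
    and conjugate-linear in the second. *)
Record hilbertType (R : realType) := HilbertType {
  hilbert_sort :> completeNormedModType R[i] ;
  inner : {dot hilbert_sort for Num.conj} ;
  innerE : forall x : hilbert_sort, inner x x = `|x| ^+ 2 }.

Notation "''<' x , y >" := (inner _ x y)
  (at level 2, x at level 69, y at level 69, format "''<' x ,  y >") : ring_scope.

(** The elements of L(V, W). *)
Definition bounded_linear (R : realType) (V W : normedModType R[i])
    (f : V -> W) : Prop :=
  linear f /\ continuous f.

(** The extension by continuity to all of [V], along [i : S -> V], of [f : S -> W]
    restricted to [D].  It is unique when the image of [D] under [i] is dense; it
    is the zero map when there is no such extension. *)
Definition cont_extension (R : realType) (V W : normedModType R[i]) (S : Type)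
    (D : set S) (i : S -> V) (f : S -> W) : V -> W :=
  xget (fun=> 0)
    [set g : V -> W | bounded_linear g /\ forall s, D s -> g (i s) = f s].

(** Unbounded operators: only the values on [dom] are meaningful. *)
Record operator (X Y : Type) := Operator { dom : set X ; opfun :> X -> Y }.

Definition total_op (X Y : Type) (f : X -> Y) : operator X Y := Operator setT f.

Section HilbertOperators.
Variable R : realType.
Implicit Types X Y : hilbertType R.

(** The value is uniquely determined on [dom (adjoint T)] when [dom T] is dense. *)
Definition adjoint X Y (T : operator X Y) : operator Y X :=
  let spec (y : Y) : set X :=
    [set w | forall x : X, dom T x -> '< T x, y > = '< x, w > ] in
  Operator [set y | exists w, spec y w] (fun y => xget 0 (spec y)).

Definition self_adjoint X (F : X -> X) : Prop :=
  bounded_linear F /\ forall x, adjoint (total_op F) x = F x.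

(** The order of [R[i]] only relates numbers with equal imaginary parts, so
    [0 <= '< F x, x >] says that this inner product is real and nonnegative. *)
Definition op_nonneg X (F : X -> X) : Prop := forall x, 0 <= '< F x, x >.

Definition op_le X (E F : X -> X) : Prop := op_nonneg (fun x => F x - E x).

(** [T] is a strongly continuous semigroup (only its values at t >= 0 matter). *)
Definition c0_semigroup X (T : R -> X -> X) : Prop :=
  [/\ forall t, 0 <= t -> bounded_linear (T t),
      forall x, T 0 x = x,
      forall s t x, 0 <= s -> 0 <= t -> T (s + t) x = T s (T t x)
    & forall x, T t x @[t --> 0^'+] --> x].

Definition generates_c0_semigroup X (A : operator X X) : Prop :=
  exists2 T : R -> X -> X, c0_semigroup T &
    forall x y, (dom A x /\ A x = y) <->
      ((t^-1)%:C *: (T t x - x) @[t --> 0^'+] --> y).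

(** [Rs] is a bounded inverse of [s I - A]. *)
Definition is_resolvent X (A : operator X X) (s : R[i]) (Rs : X -> X) : Prop :=
  [/\ bounded_linear Rs,
      forall x, dom A (Rs x) /\ s *: Rs x - A (Rs x) = x
    & forall x, dom A x -> Rs (s *: x - A x) = x].

Definition resolvent_set X (A : operator X X) : set R[i] :=
  [set s | exists Rs, is_resolvent A s Rs].

Definition resolvent X (A : operator X X) (s : R[i]) : X -> X :=
  xget (fun=> 0) (is_resolvent A s).

(** A completion of [X] with respect to the norm |(alpha I - A)^-1 x|. *)
Record extrapolation_space X (A : operator X X) (alpha : R[i]) :=
  ExtrapolationSpace {
    ext_sort :> completeNormedModType R[i] ;
    ext_inj : {linear X -> ext_sort} ;
    ext_norm : forall x, `|ext_inj x| = `|resolvent A alpha x| ;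
    ext_dense : dense (range ext_inj) }.

Section Extrapolation.
Variables (X : hilbertType R) (A : operator X X) (alpha : R[i]).
Variable Xm1 : extrapolation_space A alpha.

Definition op_extension : X -> Xm1 :=
  cont_extension (dom A) id (fun x => ext_inj Xm1 (A x)).

Definition resolvent_extension (s : R[i]) : Xm1 -> X :=
  cont_extension setT (ext_inj Xm1) (resolvent A s).

(** For [y] in D(A^* ), the extension to X_{-1} of the functional <., y> of X. *)
Definition duality_pairing (w : Xm1) (y : X) : R[i]^o :=
  cont_extension setT (ext_inj Xm1) (fun x : X => '< x, y > : R[i]^o) w.

(** B^* : D(A^* ) -> U; meaningful on D(A^* ) only. *)
Definition control_adjoint (U : hilbertType R) (B : U -> Xm1) (y : X) : U :=
  xget 0 [set w : U | forall v, duality_pairing (B v) y = '< v, w > ].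

End Extrapolation.

End HilbertOperators.

Section SystemNodes.
Variable R : realType.
Variables U X Y : hilbertType R.

(** Raw data; the axioms are in [system_node].  The value of [node_C] matters on
    the domain of [node_A] only, that of [node_G] on its resolvent set only. *)
Record node_data := NodeData {
  node_A : operator X X ;
  node_alpha : R[i] ;
  node_Xm1 : extrapolation_space node_A node_alpha ;
  node_B : U -> node_Xm1 ;
  node_C : X -> Y ;
  node_G : R[i] -> U -> Y }.

Definition rho (S : node_data) : set R[i] := resolvent_set (node_A S).

(** (s I - A)^-1 B : U -> X *)
Definition resB (S : node_data) (s : R[i]) (v : U) : X :=
  resolvent_extension s (node_B S v).

(** The third clause says that [node_C] belongs to L(X_1, Y). *)
Definition system_node (S : node_data) : Prop :=
  [/\ generates_c0_semigroup (node_A S) /\ rho S (node_alpha S),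
      bounded_linear (node_B S),
      (forall a x x', dom (node_A S) x -> dom (node_A S) x' ->
         node_C S (a *: x + x') = a *: node_C S x + node_C S x') /\
      (exists M, forall x, dom (node_A S) x ->
         `|node_C S x| <= M * `|node_alpha S *: x - node_A S x|)
    & (forall s, rho S s -> bounded_linear (node_G S s)) /\
      (forall s beta, rho S s -> rho S beta -> forall v,
         node_G S s v - node_G S beta v
         = node_C S (resB S s v - resB S beta v))].

(** [f'] is the derivative of [f] on [0, oo[ (one-sided at 0). *)
Definition derivative_on_halfline (V : normedModType R[i]) (f f' : R -> V) :=
  forall t, 0 <= t ->
    (h^-1)%:C *: (f (t + h) - f t) @[h --> within [set h | 0 <= t + h] 0^']
      --> f' t.

Definition C1_halfline (V : normedModType R[i]) (f f' : R -> V) : Prop :=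
  derivative_on_halfline f f' /\ {within [set t | 0 <= t], continuous f'}.

Definition C2_halfline (V : normedModType R[i]) (f : R -> V) : Prop :=
  exists f' f'', derivative_on_halfline f f' /\ C1_halfline f' f''.

Definition D0 (S : node_data) (z0 : X) (u : R -> U) : Prop :=
  C2_halfline u /\
  range (ext_inj (node_Xm1 S)) (op_extension (node_Xm1 S) z0 + node_B S (u 0)).

(** z is C^1 and z' = A z + B u holds in X_{-1}. *)
Definition state_trajectory (S : node_data) (z0 : X) (u : R -> U)
    (z : R -> X) : Prop :=
  z 0 = z0 /\ exists2 z', C1_halfline z z' &
    forall t, 0 <= t ->
      ext_inj (node_Xm1 S) (z' t) = op_extension (node_Xm1 S) (z t) + node_B S (u t).

Definition node_output (S : node_data) (beta : R[i]) (u : R -> U) (z : R -> X)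
    (t : R) : Y :=
  node_C S (z t - resB S beta (u t)) + node_G S beta (u t).

End SystemNodes.

Definition impedance_passive (R : realType) (U X : hilbertType R)
    (S : node_data U X U) : Prop :=
  forall z0 u z, D0 S z0 u -> state_trajectory S z0 u z ->
  forall beta, rho S beta -> forall tau : R, 0 < tau ->
    `|z tau| ^+ 2 - `|z0| ^+ 2 <=
      (2 * \int[lebesgue_measure]_(t in `[0, tau])
              complex.Re '< u t, node_output S beta u z t >)%:C.

Section Colocated.
Variables (R : realType) (U X : hilbertType R) (S : node_data U X U).

Let A := node_A S.

Definition node_Bstar : X -> U := control_adjoint (node_B S).

Definition colocated : Prop := forall x, dom A x -> node_C S x = node_Bstar x.

(** The node with generating triple (A, B, B^* ) and transfer function G + F. *)
Definition colocated_node (F : U -> U) : node_data U X U :=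
  NodeData (node_B S) node_Bstar (fun s v => node_G S s v + F v).

Definition skew_dissipative (Q : X -> X) : Prop :=
  [/\ dom A = dom (adjoint A),
      bounded_linear Q, op_nonneg Q
    & forall x, dom A x -> A x + adjoint A x = - Q x].

Definition E_op (Q : X -> X) (s : R[i]) (v : U) : U :=
  let z := resB S s v in
  - (2^-1 *: (node_G S s v + adjoint (total_op (node_G S s)) v))
  + 2^-1 *: node_Bstar (resolvent (adjoint A) s^*%C
                          ((2 * complex.Re s)%:C *: z + Q z)).

End Colocated.

(* Main.v *)
(** Write K = (s I - A)^-1 B.  Along a trajectory put w = z - K u, which lies in
    D(A); then z' = A w + s K u and y = B^* w + G(s) u.  As A^* = - A - Q on D(A)
    and <v, B^* w> = <K v, (conj s) w + A w + Q w>, expanding the inner products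
    gives the power balance
      2 Re <u, y + E u> = (|z|^2)' + <Q z, z>.
    Integrated, it yields passivity, because Q >= 0.  The right-hand side does not
    involve s, so the quadratic form of the self-adjoint operator E, hence E,
    does not depend on s.  If F is another admissible operator, comparing the
    balance with the passivity inequality as tau -> 0 gives
      0 <= <Q z0, z0> + 2 <v, (F - E) v>
    for every initial state z0 = K v + w with w in D(A): the input e^{st} v
    produces the explicit state e^{st} K v + T(t) w.  Since D(A) is dense, z0 can
    be taken arbitrarily small. *)
Require Import Defs.
From HB Require Import structures.
From mathcomp Require Import all_boot all_order all_algebra.
From mathcomp Require Import sesquilinear complex.
From mathcomp Require Import all_classical all_reals all_analysis.
From mathcomp Require Import ring lra.

Set Implicit Arguments.
Unset Strict Implicit.
Unset Printing Implicit Defensive.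

Import Order.TTheory GRing.Theory Num.Theory.
Import numFieldNormedType.Exports.

Local Open Scope classical_set_scope.
Local Open Scope ring_scope.
Local Open Scope complex_scope.

(** * Real-valued norms and bounded linear maps *)

(** The formula for E is forced by the case w = 0 of the power balance: there z = K u, z' = s K u
    and y = G(s) u, so necessarily <u, E u> = - Re <u, G(s) u> + (Re s) |K u|^2 + <Q K u, K u> / 2.
    The content is that this E also serves w <> 0. Everything is therefore moved back to X by the
    bounded K: formally B = (s I - A) K, whence B^* w = K^* (conj s I - A^* ) w. Resolvents,
    adjoints, extensions to X_{-1} and B^* are defined by choice with a default value, so each
    becomes usable only once existence (completeness, Riesz) and, where needed, uniqueness (density)
    of the chosen object are proved. Minimality needs actual trajectories. That the orbits of the
    semigroup have two-sided derivatives requires a bound on T(t) uniform on compact intervals,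
    which has to be extracted from strong continuity. *)

Section RealNorm.
Variable R : realType.
Implicit Types V W : normedModType R[i].

Lemma ReD (a b : R[i]) : complex.Re (a + b) = complex.Re a + complex.Re b.
Proof. by case: a; case: b. Qed.

Lemma ReN (a : R[i]) : complex.Re (- a) = - complex.Re a.
Proof. by case: a. Qed.

Lemma ReB (a b : R[i]) : complex.Re (a - b) = complex.Re a - complex.Re b.
Proof. by rewrite ReD ReN. Qed.

Lemma Re_conjc (a : R[i]) : complex.Re a^*%C = complex.Re a.
Proof. by case: a. Qed.

Lemma Re_realM (r : R) (a : R[i]) : complex.Re (r%:C * a) = r * complex.Re a.
Proof. by case: a => x y /=; rewrite mul0r subr0. Qed.

Lemma Re_le (a b : R[i]) : a <= b -> complex.Re a <= complex.Re b.
Proof. by rewrite lecE => /andP[]. Qed.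

Lemma rcD (a b : R) : (a + b)%:C = a%:C + b%:C :> R[i].
Proof. exact: rmorphD. Qed.

Lemma rcM (a b : R) : (a * b)%:C = a%:C * b%:C :> R[i].
Proof. exact: rmorphM. Qed.

Lemma rcN (a : R) : (- a)%:C = - a%:C :> R[i].
Proof. exact: rmorphN. Qed.

(** Norms over R[i] take values in R[i], whose order is partial. Taking the real part moves
    estimates to R, where the order is total and [lra] and [nra] apply. *)
Definition rnorm V (x : V) : R := complex.Re `|x|.

Definition cabs (a : R[i]) : R := complex.Re `|a|.

Lemma rnormE V (x : V) : `|x| = (rnorm x)%:C.
Proof. by rewrite /rnorm RRe_real // normr_real. Qed.

Lemma cabsE (a : R[i]) : `|a| = (cabs a)%:C.
Proof. by rewrite /cabs RRe_real // normr_real. Qed.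

Lemma rnorm_ge0 V (x : V) : 0 <= rnorm x.
Proof. by rewrite -lecR -rnormE normr_ge0. Qed.

Lemma cabs_ge0 (a : R[i]) : 0 <= cabs a.
Proof. by rewrite -lecR -cabsE normr_ge0. Qed.

Lemma rnorm0 V : rnorm (0 : V) = 0.
Proof. by rewrite /rnorm normr0. Qed.

Lemma rnormN V (x : V) : rnorm (- x) = rnorm x.
Proof. by rewrite /rnorm normrN. Qed.

Lemma rnormBC V (x y : V) : rnorm (x - y) = rnorm (y - x).
Proof. by rewrite /rnorm distrC. Qed.

Lemma rnormD V (x y : V) : rnorm (x + y) <= rnorm x + rnorm y.
Proof. by rewrite -lecR rcD -!rnormE ler_normD. Qed.

Lemma rnormB V (x y : V) : rnorm (x - y) <= rnorm x + rnorm y.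
Proof. by rewrite -(rnormN y) rnormD. Qed.

Lemma rnormZ V (a : R[i]) (x : V) : rnorm (a *: x) = cabs a * rnorm x.
Proof.
by rewrite /rnorm normrZ cabsE rnormE -rcM.
Qed.

Lemma cabs_real (r : R) : cabs r%:C = `|r|.
Proof. by rewrite /cabs normc_def /= expr0n /= addr0 sqrtr_sqr. Qed.

Lemma rnormZr V (r : R) (x : V) : rnorm (r%:C *: x) = `|r| * rnorm x.
Proof. by rewrite rnormZ cabs_real. Qed.

Lemma rnorm_double V (x : V) : rnorm (x + x) = 2 * rnorm x.
Proof. by rewrite -mulr2n /rnorm normrMn mulr2n ReD mulr2n mulrDl mul1r. Qed.

Lemma rnorm_le0 V (x : V) : rnorm x <= 0 -> x = 0.
Proof.
move=> x0; apply/eqP; rewrite -normr_eq0 rnormE.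
by have /eqP -> : rnorm x == 0 by rewrite eq_le x0 rnorm_ge0.
Qed.

Lemma rnorm_small V (x : V) : (forall e, 0 < e -> rnorm x <= e) -> x = 0.
Proof.
move=> h; apply: rnorm_le0; apply/ler_addgt0Pl => e e0; rewrite addr0; exact: h.
Qed.

Lemma Re_le_cabs (a : R[i]) : `|complex.Re a| <= cabs a.
Proof. by rewrite -lecR -cabsE normc_ge_Re. Qed.

Lemma cvg_rnormP V (T : Type) (F : set_system T) (FF : Filter F) (f : T -> V) l :
  f @ F --> l <-> forall e : R, 0 < e -> \forall x \near F, rnorm (l - f x) < e.
Proof.
split => [/cvgrPdist_lt h e e0|h].
  have := h e%:C; rewrite ltcR => /(_ e0).
  by apply: filterS => x; rewrite rnormE ltcR.
apply/cvgrPdist_lt => e e0.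
have eE : e = (complex.Re e)%:C by rewrite RRe_real // gtr0_real.
rewrite eE ltcR in e0; have := h _ e0.
by apply: filterS => x; rewrite eE rnormE ltcR.
Qed.

End RealNorm.

Section LinearMaps.
Variable R : realType.
Implicit Types V W : normedModType R[i].

Lemma linD V W (f : V -> W) : linear f -> forall x y, f (x + y) = f x + f y.
Proof. by move=> lf x y; have := lf 1 x y; rewrite !scale1r. Qed.

Lemma lin0 V W (f : V -> W) : linear f -> f 0 = 0.
Proof. by move=> lf; apply: (addIr (f 0)); rewrite -(linD lf) !add0r. Qed.

Lemma linZ V W (f : V -> W) : linear f -> forall a x, f (a *: x) = a *: f x.
Proof. by move=> lf a x; have := lf a x 0; rewrite (lin0 lf) !addr0. Qed.

Lemma linB V W (f : V -> W) : linear f -> forall x y, f (x - y) = f x - f y.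
Proof. by move=> lf x y; rewrite (linD lf) -scaleN1r (linZ lf) scaleN1r. Qed.

Lemma bounded_linearP V W (f : V -> W) : bounded_linear f <->
  linear f /\ exists2 M, 0 <= M & forall x, rnorm (f x) <= M * rnorm x.
Proof.
split=> [[lf cf]|[lf [M M0 hM]]]; split=> //.
  have /cvg_rnormP /(_ 1 ltr01) := cf 0.
  rewrite (lin0 lf) => /nbhs_normP[e /= e0 he].
  have eE : e = (complex.Re e)%:C by rewrite RRe_real // gtr0_real.
  rewrite eE ltcR in e0; set d := complex.Re e in eE e0.
  exists (2 / d) => [|x]; first by rewrite divr_ge0 // ltW.
  have [->|x0] := eqVneq x 0; first by rewrite (lin0 lf) !rnorm0 mulr0.
  have nx : 0 < rnorm x.
    by rewrite lt_neqAle rnorm_ge0 andbT eq_sym; apply: contra_neq x0 => h;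
      apply: rnorm_le0; rewrite h.
  pose c := d / 2 / rnorm x.
  have c0 : 0 < c by rewrite !divr_gt0.
  have := he (c%:C *: x); rewrite /ball_ /= !sub0r normrN rnormE eE ltcR.
  rewrite rnormZr gtr0_norm // /c divfK ?gt_eqF // rnormN (linZ lf) rnormZr.
  rewrite -/c gtr0_norm // => /(_ _)/ltW h.
  have {}h : c * rnorm (f x) <= 1 by apply: h; lra.
  have -> : 2 / d * rnorm x = c^-1 by rewrite /c !invfM !invrK; ring.
  by rewrite -[leRHS]mulr1 ler_pdivlMl.
move=> x; apply/cvg_rnormP => e e0.
(* A bound M may be 0, so M + 1 serves as divisor; the same device recurs below. *)
have M1 : 0 < M + 1 by rewrite ltr_wpDl.
apply/nbhs_normP; exists (e / (M + 1))%:C => /=; first by rewrite ltcR divr_gt0.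
move=> y /=; rewrite rnormE ltcR -(linB lf) => xy.
apply: le_lt_trans (hM _) _; apply: (@le_lt_trans _ _ ((M + 1) * rnorm (x - y))).
  by rewrite ler_wpM2r ?rnorm_ge0 // lerDl.
by rewrite mulrC -ltr_pdivlMr.
Qed.

Lemma blin_add V W (f g : V -> W) :
  bounded_linear f -> bounded_linear g -> bounded_linear (fun x => f x + g x).
Proof.
move=> [lf cf] [lg cg]; split.
  by move=> a x y; rewrite lf lg scalerDr addrACA.
by move=> x; apply: cvgD; [exact: cf|exact: cg].
Qed.

Lemma blin_scale V W (f : V -> W) (a : R[i]) :
  bounded_linear f -> bounded_linear (fun x => a *: f x).
Proof.
move=> [lf cf]; split.
  by move=> b x y; rewrite lf scalerDr !scalerA mulrC.
by move=> x; apply: cvgZr; exact: cf.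
Qed.

Lemma blin_opp V W (f : V -> W) :
  bounded_linear f -> bounded_linear (fun x => - f x).
Proof.
move=> [lf cf]; split; first by move=> b x y; rewrite lf opprD scalerN.
by move=> x; apply: cvgN; exact: cf.
Qed.

Lemma blin_comp V W (Z : normedModType R[i]) (f : V -> W) (g : W -> Z) :
  bounded_linear f -> bounded_linear g -> bounded_linear (fun x => g (f x)).
Proof.
move=> [lf cf] [lg cg]; split; first by move=> b x y; rewrite lf lg.
by move=> x; apply: (@continuous_comp _ _ _ f g); [exact: cf|exact: cg].
Qed.

Lemma blin_id V : bounded_linear (fun x : V => x).
Proof. by split=> // x; exact: cvg_id. Qed.

Lemma denseP (V : normedModType R[i]) (D : set V) :
  (forall x (e : R), 0 < e -> exists2 y, D y & rnorm (x - y) < e) -> dense D.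
Proof.
move=> h O [x Ox] oO; have /nbhs_normP[e /= e0 he] : nbhs x O by exact: open_nbhs_nbhs.
have eE : e = (complex.Re e)%:C by rewrite RRe_real // gtr0_real.
rewrite eE ltcR in e0; have [y Dy xy] := h x _ e0.
by exists y; split=> //; apply: he; rewrite /= rnormE eE ltcR.
Qed.

Lemma dense_rnorm (V : normedModType R[i]) (D : set V) : dense D ->
  forall x (e : R), 0 < e -> exists2 y, D y & rnorm (x - y) < e.
Proof.
move=> dD v e e0; have e0' : 0 < e%:C by rewrite ltcR.
have [|y [vy Dy]] := dD (ball v e%:C) _ (ball_open _ _).
  by exists v; exact: ballxx.
by exists y => //; move: vy; rewrite -ltcR -rnormE -ball_normE.
Qed.

Lemma blin_closure V W (f g : V -> W) (D : set V) : dense D ->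
  bounded_linear f -> bounded_linear g -> (forall x, D x -> f x = g x) -> f =1 g.
Proof.
move=> dD bf bg fg x; apply/eqP; rewrite -subr_eq0; apply/eqP.
have /bounded_linearP[lh [M M0 hM]] := blin_add bf (blin_opp bg).
apply: rnorm_small => e e0; have M1 : 0 < M + 1 by rewrite ltr_wpDl.
have [y Dy xy] := dense_rnorm dD x (divr_gt0 e0 M1).
have := hM (x - y); rewrite (linB lh) /= (fg _ Dy) subrr subr0 => /le_trans.
apply; apply: (@le_trans _ _ ((M + 1) * rnorm (x - y))).
  by rewrite ler_wpM2r ?rnorm_ge0 // lerDl.
by rewrite mulrC -ler_pdivlMr // ltW.
Qed.

Lemma rnorm_complete (W : completeNormedModType R[i]) (u : nat -> W) :
  (forall e : R, 0 < e -> exists N, forall m n, (N <= m)%N -> (N <= n)%N ->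
     rnorm (u m - u n) <= e) ->
  exists l : W, u @ \oo --> l.
Proof.
move=> hu; eexists; apply: (@cauchy_cvg W (u @ \oo)); apply: cauchy_exP => e e0.
have eE : e = (complex.Re e)%:C by rewrite RRe_real // gtr0_real.
rewrite eE ltcR in e0; have e2 : 0 < complex.Re e / 2 by rewrite divr_gt0.
have [N hN] := hu _ e2; exists (u N), N => // n Nn.
rewrite /= -ball_normE /= rnormE eE ltcR; apply: le_lt_trans (hN _ _ (leqnn _) Nn) _.
by rewrite ltr_pdivrMr // ltr_pMr // ltr1n.
Qed.

Lemma exists_invS (e : R) : 0 < e ->
  exists N, forall n, (N <= n)%N -> n.+1%:R^-1 < e.
Proof.
move=> e0; exists (Num.truncn e^-1) => n Nn; rewrite invf_plt ?posrE //.
by apply: lt_le_trans (truncnS_gt _) _; rewrite ler_nat ltnS.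
Qed.

(* The closure of the graph of [f], seen in [V * W], is the graph of the
   extension. *)
Lemma extension_exists (V : normedModType R[i]) (W : completeNormedModType R[i])
    (S : lmodType R[i]) (D : set S) (i : S -> V) (f : S -> W) (M : R) :
  (forall a x y, D x -> D y -> D (a *: x + y)) ->
  (forall a x y, i (a *: x + y) = a *: i x + i y) ->
  (forall a x y, D x -> D y -> f (a *: x + y) = a *: f x + f y) ->
  (forall x, D x -> rnorm (f x) <= M * rnorm (i x)) ->
  dense (i @` D) ->
  exists g : V -> W, bounded_linear g /\ forall s, D s -> g (i s) = f s.
Proof.
move=> linD_ lini linf fM dD.
wlog M0 : M fM / 0 <= M.
  move=> h; apply: (h `|M|) => // x Dx; apply: le_trans (fM _ Dx) _.
  by rewrite ler_wpM2r ?rnorm_ge0 // ler_norm.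
have fB x y : D x -> D y -> rnorm (f x - f y) <= M * rnorm (i x - i y).
  move=> Dx Dy; have := fM _ (linD_ (-1) _ _ Dy Dx).
  by rewrite linf // lini !scaleN1r [- f y + _]addrC [- i y + _]addrC.
have apx v (e : R) : 0 < e -> exists s, D s /\ rnorm (v - i s) < e.
  by move=> e0; have [_ [s Ds <-] h] := dense_rnorm dD v e0; exists s.
pose G v w := forall e : R, 0 < e ->
  exists s, [/\ D s, rnorm (v - i s) <= e & rnorm (w - f s) <= e].
have Gex v : exists w, G v w.
  have /choice[s hs] : forall n, exists s, D s /\ rnorm (v - i s) < n.+1%:R^-1.
    by move=> n; apply: apx; rewrite invr_gt0.
  have [w hw] : exists w : W, f (s n) @[n --> \oo] --> w.
    apply: (@rnorm_complete W (fun n => f (s n))) => e e0.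
    have [] := @exists_invS (e / 2 / (M + 1)).
      by rewrite !divr_gt0 // ltr_wpDl.
    move=> N hN; exists N => m n Nm Nn.
    apply: le_trans (fB _ _ (hs m).1 (hs n).1) _.
    have h : rnorm (i (s m) - i (s n)) <= rnorm (v - i (s m)) + rnorm (v - i (s n)).
      apply: le_trans (_ : rnorm ((v - i (s n)) - (v - i (s m))) <= _).
        by rewrite opprB [v - _ + _]addrC addrA subrK.
      by apply: le_trans (rnormB _ _) _; rewrite addrC.
    have hm := lt_trans (hs m).2 (hN _ Nm); have hn := lt_trans (hs n).2 (hN _ Nn).
    have h2 : rnorm (i (s m) - i (s n)) <= e / (M + 1).
      have -> : e / (M + 1) = e / 2 / (M + 1) + e / 2 / (M + 1).
        by rewrite -mulrDl -splitr.
      by lra.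
    apply: (@le_trans _ _ ((M + 1) * rnorm (i (s m) - i (s n)))).
      by rewrite ler_wpM2r ?rnorm_ge0 // lerDl.
    by rewrite mulrC -ler_pdivlMr // ltr_wpDl.
  exists w => e e0; have [N hN] := exists_invS e0.
  have /cvg_rnormP /(_ e e0)[N' _ hN'] := hw.
  exists (s (maxn N N')); split; first exact: (hs _).1.
    by apply/ltW/(lt_trans (hs _).2)/hN; rewrite leq_maxl.
  by apply/ltW/hN'; rewrite /= leq_maxr.
have Glin a v w v' w' : G v w -> G v' w' -> G (a *: v + v') (a *: w + w').
  move=> Gv Gv' e e0; pose d := e / (cabs a + 1).
  have a1 : 0 < cabs a + 1 by rewrite ltr_wpDl ?cabs_ge0.
  have d0 : 0 < d by rewrite divr_gt0.
  have [s [Ds s1 s2]] := Gv _ d0; have [s' [Ds' s1' s2']] := Gv' _ d0.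
  have key (N : normedModType R[i]) (x y x' y' : N) :
      rnorm (x - y) <= d -> rnorm (x' - y') <= d ->
      rnorm (a *: x + x' - (a *: y + y')) <= e.
    move=> h h'; rewrite opprD addrACA -scalerBr.
    apply: le_trans (rnormD _ _) _; rewrite rnormZ.
    have -> : e = cabs a * d + d by rewrite /d; field; exact: lt0r_neq0.
    by rewrite lerD // ler_wpM2l ?cabs_ge0.
  exists (a *: s + s'); split; first exact: linD_.
    by rewrite lini; exact: key.
  by rewrite linf //; exact: key.
have Gbd v w : G v w -> rnorm w <= M * rnorm v.
  move=> Gv; apply/ler_addgt0Pl => e e0.
  have d0 : 0 < e / (M + 1) by rewrite divr_gt0 // ltr_wpDl.
  have [s [Ds s1 s2]] := Gv _ d0.
  have h1 : rnorm w <= rnorm (w - f s) + rnorm (f s).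
    by apply: le_trans (rnormD _ _); rewrite subrK.
  have h2 : rnorm (i s) <= rnorm (v - i s) + rnorm v.
    by rewrite rnormBC; apply: le_trans (rnormD _ _); rewrite subrK.
  have h3 := fM _ Ds.
  have h4 : M * rnorm (i s) <= M * (e / (M + 1) + rnorm v).
    by rewrite ler_wpM2l //; lra.
  have -> : e = (M + 1) * (e / (M + 1)).
    by rewrite mulrCA divff ?mulr1 // gt_eqF // ltr_wpDl.
  by lra.
have Guniq v w w' : G v w -> G v w' -> w = w'.
  move=> Gw Gw'; have := Gbd _ _ (Glin (-1) _ _ _ _ Gw Gw').
  rewrite !scaleN1r !addNr rnorm0 mulr0 => /rnorm_le0 /eqP.
  by rewrite addrC subr_eq0 => /eqP ->.
have [g hg] := choice Gex; exists g; split.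
  apply/bounded_linearP; split; last by exists M => // x; exact: Gbd.
  by move=> a x y; apply: Guniq (hg _) _; exact: Glin.
move=> s Ds; apply: Guniq (hg _) _ => e e0; exists s.
by rewrite !subrr !rnorm0 ltW.
Qed.

(** One bounded extension excludes the default zero map of [xget], and density excludes any other
    choice. Every use of [cont_extension] is evaluated through this. *)
Lemma cont_extensionP (V W : normedModType R[i]) (S : Type)
    (D : set S) (i : S -> V) (f : S -> W) (g : V -> W) :
  dense (i @` D) -> bounded_linear g -> (forall s, D s -> g (i s) = f s) ->
  cont_extension D i f = g.
Proof.
move=> dD bg gf; rewrite /cont_extension.
have [bh hf] : [set g : V -> W | bounded_linear g /\ forall s, D s -> g (i s) = f s]
    (cont_extension D i f) by apply: (xgetI (fun=> 0) (x := g)).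
apply/funext; apply: blin_closure dD bh bg _ => _ [s Ds <-].
by rewrite gf // hf.
Qed.

End LinearMaps.

(** * Riesz representation and adjoints of bounded operators *)

Section InnerProduct.
Variable R : realType.
Implicit Types H K : hilbertType R.

Lemma rcn (n : nat) : n%:R%:C = n%:R :> R[i].
Proof. exact: rmorph_nat. Qed.

Lemma ReiM (z : R[i]) : complex.Re ('i%C * z) = - complex.Im z.
Proof. by rewrite mulrC ReiNIm. Qed.

Lemma conjcM (a b : R[i]) : (a * b)^*%C = a^*%C * b^*%C.
Proof. exact: rmorphM. Qed.

Lemma conjcN (a : R[i]) : (- a)^*%C = - a^*%C.
Proof. exact: rmorphN. Qed.

Lemma ipDl H (x y z : H) : '< x + y, z > = '< x, z > + '< y, z >.
Proof. exact: linearDl. Qed.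

Lemma ipZl H (a : R[i]) (x z : H) : '< a *: x, z > = a * '< x, z >.
Proof. exact: linearZl_LR. Qed.

Lemma ipC H (x y : H) : '< x, y > = '< y, x >^*%C.
Proof. by rewrite hermC expr0 mul1r. Qed.

Lemma ipDr H (x y z : H) : '< x, y + z > = '< x, y > + '< x, z >.
Proof. exact: linearDr. Qed.

Lemma ipZr H (a : R[i]) (x z : H) : '< x, a *: z > = a^*%C * '< x, z >.
Proof. by rewrite ipC ipZl conjcM -ipC. Qed.

Lemma ipNl H (x z : H) : '< - x, z > = - '< x, z >.
Proof. by rewrite -scaleN1r ipZl mulN1r. Qed.

Lemma ipNr H (x z : H) : '< x, - z > = - '< x, z >.
Proof. by rewrite ipC ipNl conjcN -ipC. Qed.

Lemma ipBl H (x y z : H) : '< x - y, z > = '< x, z > - '< y, z >.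
Proof. by rewrite ipDl ipNl. Qed.

Lemma ipBr H (x y z : H) : '< x, y - z > = '< x, y > - '< x, z >.
Proof. by rewrite ipDr ipNr. Qed.

Lemma ip0l H (z : H) : '< 0, z > = 0.
Proof. by rewrite -(scale0r 0) ipZl mul0r. Qed.

Lemma ip0r H (z : H) : '< z, 0 > = 0.
Proof. by rewrite ipC ip0l conjc0. Qed.

Lemma ip_rnorm H (x : H) : '< x, x > = (rnorm x ^+ 2)%:C.
Proof. by rewrite innerE rnormE -rmorphXn. Qed.

Lemma ip_ext H (x y : H) : (forall z, '< z, x > = '< z, y >) -> x = y.
Proof.
move=> h; apply/eqP; rewrite -subr_eq0; apply/eqP/rnorm_le0.
have := ip_rnorm (x - y); rewrite ipBr h subrr => -[] /esym/eqP.
by rewrite sqrf_eq0 => /eqP ->.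
Qed.

Lemma rnorm_sqD H (x y : H) :
  rnorm (x + y) ^+ 2 = rnorm x ^+ 2 + rnorm y ^+ 2 + 2 * complex.Re ('< x, y >).
Proof.
apply: complexI; rewrite !rcD -!ip_rnorm ipDl !ipDr (ipC y x) rcM.
rewrite rcn -addcJ; ring.
Qed.

Lemma cauchy_schwarz H (x y : H) : cabs ('< x, y >) <= rnorm x * rnorm y.
Proof.
have [->|y0] := eqVneq y 0.
  by rewrite ip0r rnorm0 mulr0 /cabs normr0.
have ny : 0 < rnorm y.
  rewrite lt_neqAle rnorm_ge0 andbT eq_sym; apply: contra_neq y0 => h.
  by apply: rnorm_le0; rewrite h.
rewrite -(@ler_pXn2r _ 2) ?nnegrE ?mulr_ge0 ?cabs_ge0 ?rnorm_ge0 //.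
set c := '< x, y >.
(* With this coefficient [x + d *: y] is the component of x orthogonal to y; the inequality is that
   its squared norm is nonnegative. *)
pose d : R[i] := - ((rnorm y ^- 2)%:C * c).
have := rnorm_sqD x (d *: y); rewrite rnormZ.
have -> : complex.Re ('< x, d *: y >) = - (rnorm y ^- 2 * cabs c ^+ 2).
  rewrite ipZr -/c /d conjcN conjcM conjc_real mulNr -mulrA ReN.
  by rewrite Re_realM (mulrC _ c) -sqr_normc cabsE -rmorphXn.
have -> : cabs d = rnorm y ^- 2 * cabs c.
  rewrite /cabs /d normrN normrM; rewrite !cabsE -rcM /= cabs_real.
  by rewrite ger0_norm // invr_ge0 exprn_ge0 // ltW.
move=> e; have := sqr_ge0 (rnorm (x + d *: y)); rewrite {}e.
have -> : (rnorm y ^- 2 * cabs c * rnorm y) ^+ 2 = rnorm y ^- 2 * cabs c ^+ 2.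
  by field; rewrite gt_eqF.
set q := _ ^- 2 * _ => h; have {h} : q <= rnorm x ^+ 2 by lra.
by rewrite /q mulrC ler_pdivrMr ?exprn_gt0 // exprMn.
Qed.

Lemma Re_ip_le H (x y : H) : complex.Re ('< x, y >) <= rnorm x * rnorm y.
Proof.
by apply: le_trans (cauchy_schwarz _ _); apply: le_trans (ler_norm _) (Re_le_cabs _).
Qed.

(** First-order condition at the minimum t = 0. When a > 0 the vertex t = - c / (2 a) gives the
    value - c^2 / (4 a); otherwise t = 1 and t = -1 suffice. *)
Lemma quadratic_ge0 (a c : R) : (forall t, 0 <= t ^+ 2 * a + t * c) -> c = 0.
Proof.
move=> h; have [a0|a0] := ltP 0 a; last first.
  by have := h 1; have := h (-1); nra.
have := h (- c / (2 * a)).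
have -> : (- c / (2 * a)) ^+ 2 * a + - c / (2 * a) * c = - (c ^+ 2 / (4 * a)).
  by field; rewrite gt_eqF.
rewrite oppr_ge0 pmulr_lle0 ?invr_gt0 ?mulr_gt0 // => c0.
by apply/eqP; rewrite -sqrf_eq0 eq_le c0 sqr_ge0.
Qed.

Lemma parallelogram H (x y : H) :
  rnorm (x + y) ^+ 2 + rnorm (x - y) ^+ 2 = 2 * rnorm x ^+ 2 + 2 * rnorm y ^+ 2.
Proof. by rewrite !rnorm_sqD rnormN ipNr ReN; ring. Qed.

(* [w] is the limit of a minimising sequence of [|x|^2 - 2 Re f x]. *)
Lemma riesz H (f : H -> R[i]) (M : R) :
  (forall a x y, f (a *: x + y) = a * f x + f y) ->
  (forall x, cabs (f x) <= M * rnorm x) ->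
  exists w, forall x, f x = '< x, w >.
Proof.
move=> lf fM.
have fD x y : f (x + y) = f x + f y by have := lf 1 x y; rewrite scale1r mul1r.
have f0 : f 0 = 0 by apply: (addIr (f 0)); rewrite -fD !add0r.
have fZ a x : f (a *: x) = a * f x by have := lf a x 0; rewrite f0 !addr0.
pose J x := rnorm x ^+ 2 - 2 * complex.Re (f x).
have Jlow x : - M ^+ 2 <= J x.
  have h1 := le_trans (ler_norm _) (le_trans (Re_le_cabs _) (fM x)).
  by rewrite /J; have := sqr_ge0 (rnorm x - M); nra.
have Jinf : has_inf (range J).
  split; first by exists (J 0), 0.
  by exists (- M ^+ 2) => _ [x _ <-].
set d := inf (range J).
have dJ x : d <= J x by apply: ge_inf; [exact: Jinf.2|exists x].
have /choice[s hs] : forall n, exists x, J x < d + n.+1%:R^-1.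
  move=> n; have n0 : 0 < n.+1%:R^-1 :> R by rewrite invr_gt0.
  by have [_ [x _ <-] hx] := inf_adherent n0 Jinf; exists x.
(* The parallelogram law, with J at least d at the midpoint, makes a minimising sequence Cauchy. *)
have Jmid x y : rnorm (x - y) ^+ 2 <= 2 * J x + 2 * J y - 4 * d.
  have := dJ ((2^-1)%:C *: (x + y)).
  rewrite /J rnormZr fZ Re_realM fD ReD exprMn.
  have -> : `|2^-1| ^+ 2 = 4^-1 :> R.
    by rewrite ger0_norm ?invr_ge0 // exprVn -natrX.
  by have := parallelogram x y; lra.
have [w hw] : exists w : H, s n @[n --> \oo] --> w.
  apply: (@rnorm_complete R H s) => e e0.
  have [] := @exists_invS R (e ^+ 2 / 4); first by rewrite divr_gt0 // exprn_gt0.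
  move=> N hN; exists N => m n Nm Nn.
  rewrite -(@ler_pXn2r _ 2) ?nnegrE ?rnorm_ge0 ?(ltW e0) //.
  apply: le_trans (Jmid _ _) _.
  have Js k : (N <= k)%N -> J (s k) < d + e ^+ 2 / 4.
    by move=> Nk; apply: lt_trans (hs k) _; rewrite ltrD2l hN.
  by have := Js m Nm; have := Js n Nn; lra.
(* This is J (h + w) >= J w in expanded form, obtained in the limit from J (h + s n) >= d > J (s n)
   - e / 2. *)
have var h : 0 <= rnorm h ^+ 2 + 2 * complex.Re ('< h, w > - f h).
  apply/ler_addgt0Pl => e e0.
  pose K := 2 * rnorm h + 1.
  have K0 : 0 < K by rewrite /K ltr_wpDl // mulr_ge0 // rnorm_ge0.
  have [] := @exists_invS R (e / 2); first by rewrite divr_gt0.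
  move=> N hN.
  have /cvg_rnormP /(_ (e / 2 / K))[|N' _ hN'] := hw; first by rewrite !divr_gt0.
  pose n := maxn N N'.
  have {}hN : J (s n) < d + e / 2.
    by apply: lt_trans (hs n) _; rewrite ltrD2l hN // leq_maxl.
  have {}hN' : rnorm (w - s n) < e / 2 / K by apply: hN'; rewrite /= leq_maxr.
  have := dJ (h + s n); have := hN.
  rewrite /J rnorm_sqD fD !ReD ReN => h1 h2.
  have h3 : complex.Re ('< h, s n >) <= complex.Re ('< h, w >) + rnorm h * rnorm (w - s n).
    have := Re_ip_le h (s n - w); rewrite rnormBC ipBr ReB; lra.
  have h4 : K * rnorm (w - s n) <= e / 2.
    by rewrite mulrC -ler_pdivlMr // ltW.
  have h5 : 2 * (rnorm h * rnorm (w - s n)) <= K * rnorm (w - s n).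
    by rewrite /K; have := rnorm_ge0 (w - s n); nra.
  by lra.
have Re_eq h : complex.Re ('< h, w >) = complex.Re (f h).
  apply/eqP; rewrite -subr_eq0; apply/eqP.
  suff : 2 * (complex.Re ('< h, w >) - complex.Re (f h)) = 0 by lra.
  apply: (@quadratic_ge0 (rnorm h ^+ 2)) => t; have := var (t%:C *: h).
  rewrite rnormZr ipZl fZ -mulrBr Re_realM ReB exprMn real_normK ?num_real //.
  by lra.
exists w => x; have := Re_eq x; have := Re_eq ('i%C *: x).
rewrite ipZl fZ !ReiM => /oppr_inj h1 h2.
by apply/eqP; rewrite eq_complex h1 h2 !eqxx.
Qed.

Definition adj H K (f : H -> K) : K -> H := adjoint (total_op f).

(** Riesz makes the set defining the adjoint inhabited, so [xget] returns a genuine representative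
    and not its default 0. *)
Lemma adjP H K (f : H -> K) : bounded_linear f ->
  forall x y, '< f x, y > = '< x, adj f y >.
Proof.
move=> /bounded_linearP[lf [M M0 fM]] x y.
have [|x'|w hw] := @riesz H (fun x => '< f x, y >) (M * rnorm y).
- by move=> a x1 x2; rewrite lf ipDl ipZl.
- apply: le_trans (cauchy_schwarz _ _) _.
  by rewrite (mulrAC M) ler_wpM2r ?rnorm_ge0.
rewrite /adj /adjoint /=; case: xgetP => [w' _ hw'|/(_ w)]; first exact: hw'.
by case=> x1 _; exact: hw.
Qed.

Lemma adjPl H K (f : H -> K) : bounded_linear f ->
  forall x y, '< adj f x, y > = '< x, f y >.
Proof. by move=> bf x y; rewrite ipC -adjP // -ipC. Qed.

Lemma adj_blin H K (f : H -> K) : bounded_linear f -> bounded_linear (adj f).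
Proof.
move=> bf; have /bounded_linearP[lf [M M0 fM]] := bf.
apply/bounded_linearP; split.
  move=> a y1 y2; apply: ip_ext => z.
  by rewrite -adjP // !ipDr !ipZr -!adjP.
exists M => // y; have [->|ny] := eqVneq (rnorm (adj f y)) 0.
  by rewrite mulr_ge0 // rnorm_ge0.
have n0 : 0 < rnorm (adj f y) by rewrite lt_neqAle rnorm_ge0 andbT eq_sym.
have : rnorm (adj f y) ^+ 2 <= rnorm (f (adj f y)) * rnorm y.
  apply: le_trans (Re_ip_le _ _); rewrite adjP // ip_rnorm //=.
have := fM (adj f y); have := rnorm_ge0 y => h1 h2 h3.
rewrite -(ler_pM2l n0) -expr2; apply: le_trans h3 _.
by rewrite mulrCA mulrA ler_wpM2r.
Qed.

Lemma adj_eq H K (f : H -> K) (g : K -> H) : bounded_linear f ->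
  (forall x y, '< f x, y > = '< x, g y >) -> adj f = g.
Proof. by move=> bf h; apply/funext => y; apply: ip_ext => z; rewrite -adjP. Qed.

(* Polarization: a complex quadratic form determines its sesquilinear form. *)
Lemma ip_polar H (f : H -> H) : linear f ->
  (forall x, '< x, f x > = 0) -> forall x, f x = 0.
Proof.
move=> lf h x; apply: ip_ext => z; rewrite ip0r.
have h1 := h (x + z); have h2 := h (x + 'i%C *: z).
rewrite (linD lf) ipDl !ipDr !h addr0 add0r in h1.
rewrite (linD lf) (linZ lf) ipDl !ipDr !ipZl !ipZr !h !mulr0 addr0 add0r in h2.
have ii : ('i%C : R[i])^*%C = - 'i%C.
  by rewrite /= /conjc; congr Complex; rewrite oppr0.
rewrite ii in h2.
have s2 := @sqr_i R.
have : 2 * '< z, f x > = 0.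
  transitivity ('< x, f z > + '< z, f x > - 'i%C * (- 'i%C * '< x, f z > + 'i%C * '< z, f x >)).
    by rewrite mulrDr !mulrA mulrN -expr2 s2; ring.
  by rewrite h1 h2 mulr0 subr0.
by move=> /eqP; rewrite mulf_eq0 pnatr_eq0 /= => /eqP.
Qed.

End InnerProduct.

(** * Resolvents and the extrapolation space *)

Section Resolvents.
Variables (R : realType) (X : hilbertType R) (A : operator X X).
Implicit Types (s b : R[i]) (x y : X).

Lemma resolventP s : resolvent_set A s -> is_resolvent A s (resolvent A s).
Proof. exact: xgetPex. Qed.

Lemma resolvent_eq s (Rs : X -> X) : is_resolvent A s Rs -> resolvent A s = Rs.
Proof.
move=> h; have [_ h1 _] : is_resolvent A s (resolvent A s) by apply: resolventP; exists Rs.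
have [_ _ h2] := h; apply/funext => x; have [Dx e] := h1 x.
by rewrite -[in RHS]e h2.
Qed.

Section FixedPoint.
Variable s : R[i].
Hypothesis rs : resolvent_set A s.

Lemma resolvent_blin : bounded_linear (resolvent A s).
Proof. by have [] := resolventP rs. Qed.

Lemma resolvent_dom x : dom A (resolvent A s x).
Proof. by have [_ h _] := resolventP rs; case: (h x). Qed.

Lemma op_resolvent x : A (resolvent A s x) = s *: resolvent A s x - x.
Proof.
have [_ h _] := resolventP rs; case: (h x) => _ e.
by rewrite -[in X in _ - X]e subKr.
Qed.

Lemma resolventK x : dom A x -> resolvent A s (s *: x - A x) = x.
Proof. by have [_ _ h] := resolventP rs; exact: h. Qed.

Lemma resolvent_op x : dom A x ->
  resolvent A s (A x) = s *: resolvent A s x - x.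
Proof.
move=> /resolventK; have lR := resolvent_blin.1.
rewrite (linB lR) (linZ lR) => e; apply/eqP.
by rewrite eq_sym subr_eq addrC -subr_eq; apply/eqP.
Qed.

(** The record [operator] carries no linearity: it is inherited from the resolvent, which is linear
    and has the domain of A as its range. *)
Lemma op_linear a x y : dom A x -> dom A y ->
  dom A (a *: x + y) /\ A (a *: x + y) = a *: A x + A y.
Proof.
move=> /resolventK; move: (s *: x - A x) => p ex.
move=> /resolventK; move: (s *: y - A y) => q ey.
have lR := resolvent_blin.1; have e := lR a p q.
rewrite -ex -ey -e; split; first exact: resolvent_dom.
rewrite !op_resolvent e scalerDr scalerBr opprD addrACA.
by rewrite !scalerA (mulrC a).
Qed.

Lemma op_domD x y : dom A x -> dom A y -> dom A (x + y).
Proof. by move=> Dx Dy; have [] := op_linear 1 Dx Dy; rewrite scale1r. Qed.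

Lemma op_dom0 : dom A 0.
Proof. by rewrite -(lin0 resolvent_blin.1); exact: resolvent_dom. Qed.

Lemma op_0 : A 0 = 0.
Proof.
by have := op_resolvent 0; rewrite (lin0 resolvent_blin.1) scaler0 subrr.
Qed.

Lemma op_domZ a x : dom A x -> dom A (a *: x).
Proof. by move=> Dx; have [] := op_linear a Dx op_dom0; rewrite addr0. Qed.

Lemma op_domB x y : dom A x -> dom A y -> dom A (x - y).
Proof. by move=> Dx Dy; rewrite -scaleN1r; apply: op_domD => //; exact: op_domZ. Qed.

Lemma op_scale a x : dom A x -> A (a *: x) = a *: A x.
Proof. by move=> Dx; have [_] := op_linear a Dx op_dom0; rewrite op_0 !addr0. Qed.

Lemma resolvent_identity b x : resolvent_set A b ->
  resolvent A s x = resolvent A b x + (b - s) *: resolvent A s (resolvent A b x).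
Proof.
move=> rb; have [_ h _] := resolventP rb; case: (h x) => Dx e.
rewrite -[in LHS]e; set y := resolvent A b x in Dx e *.
have lR := resolvent_blin.1.
have -> : b *: y - A y = (s *: y - A y) + (b - s) *: y.
  by rewrite scalerBl [RHS]addrC addrA subrK.
by rewrite (linD lR) (linZ lR) resolventK.
Qed.

End FixedPoint.

(** T t is continuous and commutes with T k, so it carries the difference quotients of x to those of
    T t x. *)
Lemma generator_semigroup (T : R -> X -> X) t x : c0_semigroup T ->
  (forall x y, (dom A x /\ A x = y) <->
      ((t^-1)%:C *: (T t x - x) @[t --> 0^'+] --> y)) ->
  0 <= t -> dom A x -> dom A (T t x) /\ A (T t x) = T t (A x).
Proof.
move=> [bT T0 TD Tc] gA t0 Dx; have /gA h : dom A x /\ A x = A x by [].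
have [_ cTt] := bT _ t0; have lTt := (bT _ t0).1.
apply/gA; have : T t ((h^-1)%:C *: (T h x - x)) @[h --> 0^'+] --> T t (A x).
  by apply: (continuous_cvg _ _ h); exact: cTt.
apply: cvg_trans; apply: near_eq_cvg; near=> k.
have k0 : 0 <= k by near: k; apply: nbhs_right_ge.
by rewrite (linZ lTt) (linB lTt) -(TD t k) // -(TD k t) // (addrC k).
Unshelve. all: by end_near. Qed.

(* Every [x] is [s w - A w] with [w] in the domain, and [A w] is a limit of
   difference quotients [(T t w - w) / t], which lie in the domain as it is
   invariant under the semigroup. *)
Lemma generator_dense (T : R -> X -> X) s : c0_semigroup T ->
  (forall x y, (dom A x /\ A x = y) <->
      ((t^-1)%:C *: (T t x - x) @[t --> 0^'+] --> y)) ->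
  resolvent_set A s -> dense (dom A).
Proof.
move=> hT gA rs.
apply: denseP => x e e0; pose w := resolvent A s x.
have Dw : dom A w by exact: resolvent_dom.
have /gA/cvg_rnormP/(_ e e0) h : dom A w /\ A w = A w by [].
near (0:R)^'+ => t.
have t0 : 0 <= t by near: t; apply: nbhs_right_ge.
exists (s *: w - (t^-1)%:C *: (T t w - w)).
  apply: (op_domB rs); first exact: (op_domZ rs).
  by apply: (op_domZ rs); apply: (op_domB rs) => //; case: (generator_semigroup hT gA t0 Dw).
have -> : x = s *: w - A w by rewrite (op_resolvent rs) subKr.
rewrite opprB addrC addrA subrK rnormBC; near: t.
by [].
Unshelve. all: by end_near. Qed.

End Resolvents.

Section Extrapolation.
Variables (R : realType) (X : hilbertType R) (A : operator X X) (alpha : R[i]).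
Variable Xm1 : extrapolation_space A alpha.
Hypotheses (ra : resolvent_set A alpha) (dA : dense (dom A)).
Let j := ext_inj Xm1.

Lemma rnorm_ext_inj x : rnorm (j x) = rnorm (resolvent A alpha x).
Proof. by rewrite /rnorm /j ext_norm. Qed.

Lemma ext_inj_linear : linear j.
Proof. by move=> a x y; rewrite linearP. Qed.

Lemma ext_inj_blin : bounded_linear j.
Proof.
apply/bounded_linearP; split; first exact: ext_inj_linear.
have /bounded_linearP[_ [M M0 h]] := resolvent_blin ra.
by exists M => // x; rewrite rnorm_ext_inj.
Qed.

Lemma ext_inj_dense : dense (j @` setT).
Proof. exact: ext_dense. Qed.

(** The norm of [j x] is that of R_alpha x. The identity R_s x = R_alpha x + (alpha - s) R_s R_alpha
    x therefore bounds R_s x by 1 + |alpha - s| M times that norm, where M bounds R_s. *)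
Lemma resolvent_ext_spec s : resolvent_set A s ->
  bounded_linear (resolvent_extension (Xm1 := Xm1) s) /\
  forall x, resolvent_extension s (j x) = resolvent A s x.
Proof.
move=> rs; have bR := resolvent_blin rs; have lR := bR.1.
have /bounded_linearP[_ [M M0 hM]] := bR.
have [||||g [bg hg]] := @extension_exists R Xm1 X X setT j (resolvent A s)
    (1 + cabs (alpha - s) * M) _ _ _ _ ext_inj_dense.
- by [].
- exact: ext_inj_linear.
- by move=> a x y _ _; exact: lR.
- move=> x _; rewrite (resolvent_identity rs x ra) rnorm_ext_inj.
  apply: le_trans (rnormD _ _) _; rewrite rnormZ mulrDl mul1r lerD2l -mulrA.
  by rewrite ler_wpM2l ?cabs_ge0.
rewrite /resolvent_extension (cont_extensionP ext_inj_dense bg hg).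
by split=> // x; rewrite hg.
Qed.

(** The norm of A x in X_{-1} is that of R_alpha A x = alpha R_alpha x - x, which is bounded in the
    norm of X. *)
Lemma op_ext_spec : bounded_linear (op_extension Xm1) /\
  forall x, dom A x -> op_extension Xm1 x = j (A x).
Proof.
have bR := resolvent_blin ra; have lR := bR.1.
have /bounded_linearP[_ [M M0 hM]] := bR.
have dA' : dense ((fun x : X => x) @` dom A) by rewrite image_id.
have [||||g [bg hg]] := @extension_exists R X Xm1 X (dom A) id (fun x => j (A x))
    (cabs alpha * M + 1) _ _ _ _ dA'.
- by move=> a x y Dx Dy; have [] := op_linear ra a Dx Dy.
- by [].
- by move=> a x y Dx Dy; have [_ ->] := op_linear ra a Dx Dy; exact: ext_inj_linear.
- move=> x Dx; rewrite rnorm_ext_inj.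
  rewrite (resolvent_op ra Dx).
  apply: le_trans (rnormB _ _) _; rewrite rnormZ mulrDl mul1r lerD2r -mulrA.
  by rewrite ler_wpM2l ?cabs_ge0.
by rewrite /op_extension (cont_extensionP dA' bg hg).
Qed.

Section FixedPoint.
Variable s : R[i].
Hypothesis rs : resolvent_set A s.

Lemma resolvent_ext_blin : bounded_linear (resolvent_extension (Xm1 := Xm1) s).
Proof. exact: (resolvent_ext_spec rs).1. Qed.

Lemma resolvent_extE x : resolvent_extension s (j x) = resolvent A s x.
Proof. exact: (resolvent_ext_spec rs).2. Qed.

Lemma resolvent_ext_identity b (w : Xm1) : resolvent_set A b ->
  resolvent_extension s w =
  resolvent_extension b w + (b - s) *: resolvent A s (resolvent_extension b w).
Proof.
move=> rb; have [bb hb] := resolvent_ext_spec rb.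
apply: (blin_closure ext_inj_dense (f := resolvent_extension (Xm1 := Xm1) s)
  (g := fun w => resolvent_extension b w +
                 (b - s) *: resolvent A s (resolvent_extension b w))).
- exact: resolvent_ext_blin.
- by apply: blin_add => //; apply: blin_scale; apply: blin_comp bb (resolvent_blin rs).
by move=> _ [x _ <-]; rewrite resolvent_extE hb; exact: resolvent_identity.
Qed.

(** Checked on the dense image of X. Together with [resolvent_ext_op], checked on D(A), it makes s I
    - A an isomorphism from X onto X_{-1}. *)
Lemma op_resolvent_ext (w : Xm1) :
  s *: j (resolvent_extension s w) - op_extension Xm1 (resolvent_extension s w) = w.
Proof.
have [bA hA] := op_ext_spec; have bR := resolvent_ext_blin.
apply: (blin_closure ext_inj_dense (g := id)
  (f := fun w => s *: j (resolvent_extension s w)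
                 - op_extension Xm1 (resolvent_extension s w))).
- apply: blin_add; first by apply/blin_scale/(blin_comp bR)/ext_inj_blin.
  by apply: blin_opp; exact: blin_comp bR bA.
- exact: blin_id.
move=> _ [x _ <-]; rewrite resolvent_extE hA; last exact: resolvent_dom.
rewrite -(linZ ext_inj_linear) -(linB ext_inj_linear) op_resolvent //.
by rewrite subKr.
Qed.

Lemma resolvent_ext_op (x : X) :
  resolvent_extension s (s *: j x - op_extension Xm1 x) = x.
Proof.
have [bA hA] := op_ext_spec; have bR := resolvent_ext_blin.
apply: (blin_closure dA (g := id)
  (f := fun x => resolvent_extension s (s *: j x - op_extension Xm1 x))).
- apply: (blin_comp _ bR); apply: blin_add; last exact: blin_opp.
  by apply/blin_scale/ext_inj_blin.
- exact: blin_id.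
move=> y Dy; rewrite hA // -(linZ ext_inj_linear) -(linB ext_inj_linear).
by rewrite resolvent_extE resolventK.
Qed.

End FixedPoint.

End Extrapolation.

(** * Adjoint of a densely defined operator and of its resolvent *)

Section Adjoints.
Variables (R : realType) (X : hilbertType R) (A : operator X X).
Hypothesis dA : dense (dom A).

Lemma ip_ext_dense (x y : X) : (forall z, dom A z -> '< z, x > = '< z, y >) -> x = y.
Proof.
move=> h; apply/eqP; rewrite -subr_eq0; apply/eqP; apply: rnorm_small => e e0.
have [z Dz xz] := dense_rnorm dA (x - y) e0.
have := Re_ip_le (x - y - z) (x - y).
rewrite ipBl (ipBr z) h // subrr subr0 ip_rnorm /= => h1.
have [->|n0] := eqVneq (rnorm (x - y)) 0; first exact: ltW.
have {}n0 : 0 < rnorm (x - y) by rewrite lt_neqAle rnorm_ge0 andbT eq_sym.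
by move: h1; rewrite expr2 ler_pM2r // => /le_trans; apply; apply: ltW.
Qed.

Lemma adjointP (x y : X) : dom (adjoint A) y -> dom A x ->
  '< A x, y > = '< x, adjoint A y >.
Proof.
move=> [w hw] Dx; rewrite /adjoint /=; case: xgetP => [w' _ h|/(_ w)]; first exact: h.
by case; exact: hw.
Qed.

Lemma adjoint_eq (y w : X) : (forall x, dom A x -> '< A x, y > = '< x, w >) ->
  dom (adjoint A) y /\ adjoint A y = w.
Proof.
move=> h; have Dy : dom (adjoint A) y by exists w.
by split=> //; apply: ip_ext_dense => z Dz; rewrite -adjointP // h.
Qed.

(** Turns the resolvent of A^* that occurs in [E_op] into the adjoint of a bounded operator. *)
Lemma resolvent_adjoint s : resolvent_set A s ->
  is_resolvent (adjoint A) s^*%C (adj (resolvent A s)).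
Proof.
move=> rs; have bR := resolvent_blin rs; have lR := bR.1.
split; first exact: adj_blin.
  move=> x; have [|D e] := @adjoint_eq (adj (resolvent A s) x)
      (s^*%C *: adj (resolvent A s) x - x).
    move=> y Dy; rewrite -adjP //.
    rewrite (resolvent_op rs Dy).
    by rewrite ipBl ipZl ipBr ipZr conjcK adjP.
  by split=> //; rewrite e subKr.
move=> y Dy; apply: ip_ext => x; rewrite -adjP // ipBr ipZr conjcK -adjointP //.
  by rewrite op_resolvent // ipBl ipZl subKr.
exact: resolvent_dom.
Qed.

End Adjoints.

(** * The operator E and the power balance *)

Section NodeAlgebra.
Variables (R : realType) (U X : hilbertType R) (S : node_data U X U) (Q : X -> X).
Hypotheses (hS : system_node S) (hA : skew_dissipative S Q) (hC : colocated S).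
Let A := node_A S.

Lemma node_rho_alpha : rho S (node_alpha S).
Proof. by have [[]] := hS. Qed.
Let ra := node_rho_alpha.

Lemma node_dense : dense (dom A).
Proof.
have [[[T hT gA] _] _ _ _] := hS.
exact: generator_dense hT gA ra.
Qed.
Let dA := node_dense.

Lemma node_B_blin : bounded_linear (node_B S).
Proof. by have [] := hS. Qed.

Lemma node_G_blin s : rho S s -> bounded_linear (node_G S s).
Proof. by have [_ _ _ [h _]] := hS; exact: h. Qed.

Lemma node_Q_blin : bounded_linear Q.
Proof. by have [] := hA. Qed.

Lemma resB_blin s : rho S s -> bounded_linear (resB S s).
Proof.
move=> rs; apply: (blin_comp node_B_blin (g := resolvent_extension s)).
exact: resolvent_ext_blin.
Qed.

Lemma resB_diff s b v : rho S s -> rho S b ->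
  resB S s v - resB S b v = (b - s) *: resolvent A s (resB S b v).
Proof.
move=> rs rb; rewrite /resB (resolvent_ext_identity ra rs _ rb).
by rewrite addrC addKr.
Qed.

Lemma resB_diff_dom s b v : rho S s -> rho S b ->
  dom A (resB S s v - resB S b v).
Proof.
move=> rs rb; rewrite resB_diff //; apply: (op_domZ rs).
exact: resolvent_dom.
Qed.

Lemma dom_adjoint y : dom A y -> dom (adjoint A) y.
Proof. by have [-> _ _ _] := hA. Qed.

Lemma adjointE y : dom A y -> adjoint A y = - A y - Q y.
Proof.
have [_ _ _ h] := hA => Dy.
by rewrite -(h _ Dy) addrA addNr add0r.
Qed.

Lemma ip_op x y : dom A x -> dom A y -> '< A x, y > = '< x, - A y - Q y >.
Proof. by move=> Dx Dy; rewrite -adjointE // adjointP //; exact: dom_adjoint. Qed.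

(** Nonnegativity in R[i] forces <Q z, z> to be real, hence equal to its conjugate; polarization
    then gives Q = Q^*. *)
Lemma Q_sym x y : '< Q x, y > = '< x, Q y >.
Proof.
have bQ := node_Q_blin; have bQa := adj_blin bQ.
have bD := blin_add bQ (blin_opp bQa).
have h : forall x, Q x - adj Q x = 0.
  apply: (ip_polar bD.1) => z; rewrite ipBr -adjP // ipC.
  have [_ _ /(_ z) hz _] := hA.
  rewrite -[X in _ - X](RRe_real (ger0_real hz)).
  by rewrite -[in X in X^*%C](RRe_real (ger0_real hz)) conjc_real subrr.
by rewrite adjP //; have /eqP := h y; rewrite subr_eq0 => /eqP <-.
Qed.

(** Formally B v = (s I - A) K v, so <B v, y> = <K v, (conj s I - A^* ) y>, and - A^* y = A y + Q y.
    As a functional of w in X_{-1} the right side is bounded, so it is enough to verify it on the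
    image of X. *)
Lemma pairing_resB s v y : rho S s -> dom A y ->
  duality_pairing (node_B S v) y = '< resB S s v, s^*%C *: y + A y + Q y >.
Proof.
move=> rs Dy; rewrite /duality_pairing.
rewrite (@cont_extensionP _ _ _ _ _ _ _ (fun w : node_Xm1 S =>
  '< resolvent_extension s w, s^*%C *: y + A y + Q y > : R[i]^o)) //.
- exact: ext_inj_dense.
- apply/bounded_linearP.
  have /bounded_linearP[lR [M M0 hM]] := resolvent_ext_blin (node_Xm1 S) ra rs.
  split; first by move=> a x1 x2; rewrite lR ipDl ipZl.
  set q := _ + Q y; exists (M * rnorm q); first by rewrite mulr_ge0 // rnorm_ge0.
  move=> x; apply: le_trans (cauchy_schwarz _ _) _.
  by rewrite mulrAC ler_wpM2r ?rnorm_ge0.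
move=> x _; rewrite (resolvent_extE _ ra rs); set r := resolvent _ _ _.
have Dr : dom A r by exact: resolvent_dom.
have -> : x = s *: r - A r by rewrite (op_resolvent rs) subKr.
rewrite ipBl (ip_op Dr Dy) !ipDr ipZr conjcK ipZl !ipNr opprB opprK.
by rewrite -addrA [X in _ + X]addrC.
Qed.

(** The adjoint of the bounded K supplies the vector that [control_adjoint] asks for, so the choice
    made there is not the default. *)
Lemma node_BstarE s y : rho S s -> dom A y ->
  node_Bstar S y = adj (resB S s) (s^*%C *: y + A y + Q y).
Proof.
move=> rs Dy; set w := RHS.
have hw v : duality_pairing (node_B S v) y = '< v, w >.
  by rewrite (pairing_resB _ rs) // /w -adjP //; exact: resB_blin.
apply: ip_ext => v; rewrite -hw /node_Bstar /control_adjoint.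
by case: xgetP => [w' _ ->|/(_ w)] //; case.
Qed.

(** Put y = R_s^* x. It lies in D(A^* ) = D(A), and there conj s y + A y + Q y = (conj s I - A^* ) y
    = x, so the formula for B^* y collapses to K^* x. *)
Lemma node_Bstar_resolvent s x : rho S s ->
  node_Bstar S (resolvent (adjoint A) s^*%C x) = adj (resB S s) x.
Proof.
move=> rs; have rsa := resolvent_adjoint dA rs.
rewrite (resolvent_eq rsa); have [_ h _] := rsa; have [D e] := h x.
have [hdom _ _ _] := hA; have {}D : dom A (adj (resolvent A s) x).
  by rewrite /A hdom.
rewrite (node_BstarE rs) //; congr adj.
by rewrite -[RHS]e adjointE // opprB opprK -[LHS]addrA (addrC (A _)).
Qed.

(** In the form - (G + G^* ) / 2 + K^* (2 Re s + Q) K / 2 only bounded operators remain, and E is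
    visibly self-adjoint. *)
Lemma E_opE s v : rho S s -> let b := resB S s v in
  E_op S Q s v = - (2^-1 *: (node_G S s v + adj (node_G S s) v))
   + 2^-1 *: adj (resB S s) ((2 * complex.Re s)%:C *: b + Q b).
Proof. by move=> rs b; rewrite /E_op node_Bstar_resolvent. Qed.

Lemma E_op_blin s : rho S s -> bounded_linear (E_op S Q s).
Proof.
move=> rs; have -> : E_op S Q s = fun v =>
   - (2^-1 *: (node_G S s v + adj (node_G S s) v))
   + 2^-1 *: adj (resB S s) ((2 * complex.Re s)%:C *: resB S s v + Q (resB S s v)).
  by apply/funext => v; exact: E_opE.
have bG := node_G_blin rs; have bK := resB_blin rs.
apply: blin_add; first by apply/blin_opp/blin_scale/blin_add/adj_blin.
apply/blin_scale/(blin_comp _ (adj_blin bK)).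
by apply: blin_add; [exact: blin_scale|exact: blin_comp bK node_Q_blin].
Qed.

Lemma E_op_sym s u v : rho S s -> '< E_op S Q s u, v > = '< u, E_op S Q s v >.
Proof.
move=> rs; rewrite !E_opE //; have bG := node_G_blin rs; have bK := resB_blin rs.
have ch : ((2^-1 : R[i])^*%C) = 2^-1 by rewrite conjc_inv conjc_nat.
have ar : ((2 * complex.Re s)%:C : R[i])^*%C = (2 * complex.Re s)%:C.
  exact: conjc_real.
set a := (2 * complex.Re s)%:C in ar *.
rewrite ipDl ipNl !ipZl ipDl !adjPl // ipDr ipNr !ipZr ipDr ch -!adjP //.
rewrite ipDl ipDr ipZl ipZr ar Q_sym; ring.
Qed.

Lemma E_op_self_adjoint s : rho S s -> self_adjoint (E_op S Q s).
Proof.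
move=> rs; have bE := E_op_blin rs; split=> // x.
rewrite -[LHS]/(adj _ x) (adj_eq bE (g := E_op S Q s)) //.
by move=> u v; exact: E_op_sym.
Qed.

Lemma Re_E_op s v : rho S s -> let b := resB S s v in
  complex.Re '< v, E_op S Q s v > =
  - complex.Re '< v, node_G S s v > + complex.Re s * rnorm b ^+ 2
  + 2^-1 * complex.Re '< b, Q b >.
Proof.
move=> rs b; rewrite E_opE //; have bG := node_G_blin rs; have bK := resB_blin rs.
have ch : ((2^-1 : R[i])^*%C) = (2^-1)%:C.
  by rewrite conjc_inv conjc_nat -[RHS]/((2^-1 : R)%:C) fmorphV rmorph_nat.
rewrite ipDr ipNr !ipZr ch ipDr -!adjP // ReD ReN !Re_realM ReD.
rewrite (ipC _ v). rewrite Re_conjc ipDr ReD ipZr conjc_real Re_realM -/b ip_rnorm /=.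
by field.
Qed.

(** Terms in w alone cancel because 2 Re <A w, w> = - <Q w, w>; terms in b = K v alone are what E
    was defined to match; the cross terms are exactly 2 Re <b, (conj s) w + A w + Q w> = 2 Re <v,
    B^* w>. *)
Lemma power_balance s v w : rho S s -> dom A w ->
  let z := w + resB S s v in let z' := A w + s *: resB S s v in
  2 * complex.Re '< v, node_Bstar S w + node_G S s v + E_op S Q s v > =
  2 * complex.Re '< z', z > + complex.Re '< Q z, z >.
Proof.
move=> rs Dw /=; set b := resB S s v; have bK := resB_blin rs.
have := Re_E_op v rs; move: (E_op S Q s v) => e /= he.
rewrite !(ipDr v) !ReD he -/b (node_BstarE rs Dw) -adjP // -/b.
have bQ := node_Q_blin; rewrite (linD bQ.1).
rewrite !(ipDl, ipDr) !ReD !ipZl !ipZr conjcK ip_rnorm.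
have h1 : 2 * complex.Re '< A w, w > = - complex.Re '< Q w, w >.
  have := congr1 (@complex.Re R) (ip_op Dw Dw); rewrite ipBr ipNr ReB ReN -Q_sym.
  by rewrite (ipC w (A w)) Re_conjc; lra.
have h2 : complex.Re (s * (rnorm b ^+ 2)%:C) = complex.Re s * rnorm b ^+ 2.
  by rewrite mulrC Re_realM mulrC.
rewrite h2 (ipC (A w) b) Re_conjc.
have -> : complex.Re '< Q w, b > = complex.Re '< b, Q w >.
  by rewrite ipC Re_conjc.
have -> : complex.Re '< Q b, w > = complex.Re '< b, Q w > by rewrite Q_sym.
have -> : complex.Re '< Q b, b > = complex.Re '< b, Q b > by rewrite Q_sym.
by move: h1; lra.
Qed.

(** With K' the operator K taken at s', the state K' x splits at s as w + K x and at s' as 0 + K' x.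
    Both splittings have the same z, the same z' = s' K' x and, by the transfer function identity,
    the same output, so the two balances can only agree if the forms of E do. *)
Lemma E_op_indep s s' v : rho S s -> rho S s' -> E_op S Q s v = E_op S Q s' v.
Proof.
move=> rs rs'; apply/eqP; rewrite -subr_eq0; apply/eqP.
have bE := E_op_blin rs; have bE' := E_op_blin rs'.
apply: (ip_polar (f := fun v => E_op S Q s v - E_op S Q s' v)) => [|x].
  exact: (blin_add bE (blin_opp bE')).1.
(* The form is real, so the balance, which sees real parts only, determines it. *)
have sym : ('< x, E_op S Q s x - E_op S Q s' x >)^*%C = '< x, E_op S Q s x - E_op S Q s' x >.
  by rewrite -ipC ipBl ipBr !E_op_sym.
suff : complex.Re ('< x, E_op S Q s x - E_op S Q s' x >) = 0.
  move: sym; case: ('< _, _ >) => p q [] /= e ->.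
  by have -> : q = 0 by lra.
set w := resB S s' x - resB S s x; have Dw : dom A w by exact: resB_diff_dom.
have h1 := power_balance x rs Dw.
have h2 := power_balance x rs' (op_dom0 ra); move: h1 h2 => /=.
rewrite (_ : w + resB S s x = resB S s' x); last by rewrite /w subrK.
rewrite add0r (op_0 ra) add0r.
have -> : A w + s *: resB S s x = s' *: resB S s' x.
  rewrite /w resB_diff // (op_scale rs') ?(op_resolvent rs'); last exact: resolvent_dom.
  have -> : resB S s' x = resB S s x + (s - s') *: resolvent A s' (resB S s x).
    by rewrite -resB_diff // addrC subrK.
  rewrite scalerBr !scalerDr !scalerA mulrC -addrA addrC; congr (_ + _).
  by rewrite scalerBl opprB subrK.
have -> : node_Bstar S w = node_G S s' x - node_G S s x.
  have [_ _ _ [_ hG]] := hS.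
  by rewrite -hC // hG.
have -> : node_Bstar S 0 = 0.
  rewrite -hC; last exact: (op_dom0 ra).
  have [_ _ [hl _] _] := hS.
  have := hl (-1) 0 0 (op_dom0 ra) (op_dom0 ra).
  by rewrite scaler0 addr0 scaleN1r addNr.
move: (E_op S Q s x) (E_op S Q s' x) => e e'.
by rewrite subrK add0r !(ipDr x) ipNr !ReD ReN; lra.
Qed.

End NodeAlgebra.

(** * Calculus on the half-line *)

Section Calculus.
Variable R : realType.
Implicit Types V W : normedModType R[i].
Implicit Types H : hilbertType R.

Lemma blin_cvg V W (T : Type) (F : set_system T) {FF : Filter F} (f : V -> W)
    (g : T -> V) (l : V) :
  bounded_linear f -> g @ F --> l -> f (g x) @[x --> F] --> f l.
Proof. by move=> [_ cf] gl; apply: (cvg_comp g f gl); exact: cf. Qed.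

Lemma rnorm_cvg V (T : Type) (F : set_system T) {FF : Filter F} (g : T -> V) (l : V) :
  g @ F --> l -> rnorm (g x) @[x --> F] --> rnorm l.
Proof.
move=> /cvg_rnormP gl; apply/cvgrPdist_lt => e e0; have := gl e e0.
apply: filterS => x; apply: le_lt_trans; rewrite ler_norml lerBlDr.
have h1 : rnorm l <= rnorm (l - g x) + rnorm (g x).
  by apply: le_trans (rnormD _ _); rewrite subrK.
have h2 : rnorm (g x) <= rnorm (l - g x) + rnorm l.
  by rewrite rnormBC; apply: le_trans (rnormD _ _); rewrite subrK.
by apply/andP; split; lra.
Qed.

(** Polarization reduces joint continuity of the inner product to that of the norm and of
    addition. *)
Lemma Re_ip_cvg H (T : Type) (F : set_system T) {FF : Filter F} (f g : T -> H) (a b : H) :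
  f @ F --> a -> g @ F --> b ->
  complex.Re '< f x, g x > @[x --> F] --> complex.Re '< a, b >.
Proof.
move=> fa gb.
have E x y : complex.Re ('< x, y > : R[i]) =
    2^-1 * (rnorm (x + y : H) ^+ 2 - rnorm x ^+ 2 - rnorm y ^+ 2).
  by rewrite rnorm_sqD; field.
rewrite E; under eq_fun do rewrite E.
have sq h (l : H) : h @ F --> l -> rnorm (h x) ^+ 2 @[x --> F] --> rnorm l ^+ 2.
  by move=> hl; rewrite expr2; under eq_fun do rewrite expr2; apply: cvgM; exact: rnorm_cvg.
apply: cvgM; first exact: cvg_cst.
apply: cvgB; last exact: sq.
apply: cvgB; last exact: sq.
by apply: (sq (fun x => f x + g x)); exact: cvgD.
Qed.

Lemma derivative_on_halflineP V (f f' : R -> V) : derivative_on_halfline f f' <->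
  forall t, 0 <= t -> forall e, 0 < e -> exists2 d, 0 < d &
    forall h, h != 0 -> `|h| < d -> 0 <= t + h ->
      rnorm (f' t - (h^-1)%:C *: (f (t + h) - f t)) < e.
Proof.
split=> h t t0.
  move=> e e0; have /cvg_rnormP/(_ e e0) := h t t0.
  move=> /nbhs_normP[d /= d0 hd]; exists d => // k k0 kd tk.
  by apply: hd => //=; rewrite sub0r normrN.
apply/cvg_rnormP => e e0; have [d d0 hd] := h t t0 e e0.
apply/nbhs_normP; exists d => //= k; rewrite /= sub0r normrN => kd k0 tk.
exact: hd.
Qed.

Lemma derivative_halfline_dist V (f f' : R -> V) t : derivative_on_halfline f f' ->
  0 <= t -> forall e, 0 < e -> exists2 d, 0 < d &
    forall h, `|h| < d -> 0 <= t + h -> rnorm (f t - f (t + h)) < e.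
Proof.
move=> /derivative_on_halflineP hf t0 e e0; have [d d0 hd] := hf t t0 1 ltr01.
(* Bounds the difference quotients for |h| < d, where they are within 1 of [f' t]. *)
pose c := 1 + rnorm (f' t).
have c0 : 0 < c by rewrite ltr_wpDr ?rnorm_ge0.
exists (Num.min d (e / c)); first by rewrite lt_min d0 divr_gt0.
move=> h; rewrite lt_min => /andP[h1 h2] th.
have [->|h0] := eqVneq h 0; first by rewrite addr0 subrr rnorm0.
have /ltW h3 := hd h h0 h1 th; set q := _ *: _ in h3.
have -> : f t - f (t + h) = - (h%:C *: q).
  rewrite /q scalerA -rcM divff // scale1r opprB //.
rewrite rnormN rnormZr; apply: (@le_lt_trans _ _ (`|h| * c)).
  rewrite ler_wpM2l //; have -> : q = f' t - (f' t - q) by rewrite subKr.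
  by apply: le_trans (rnormB _ _) _; rewrite /c addrC lerD2r.
by rewrite -ltr_pdivlMr.
Qed.

Lemma derivative_halfline_continuous V (f f' : R -> V) :
  derivative_on_halfline f f' -> {within [set t | 0 <= t], continuous f}.
Proof.
move=> hf; apply/subspace_continuousP => t /= t0.
apply/cvg_rnormP => e e0; have [d d0 hd] := derivative_halfline_dist hf t0 e0.
apply/nbhs_normP; exists d => //= s /= ts s0.
have -> : s = t + (s - t) by rewrite addrC subrK.
by apply: hd; rewrite ?[t + _]addrC ?subrK // distrC.
Qed.

Lemma Re_ip_within H (A : set R) (f g : R -> H) :
  {within A, continuous f} -> {within A, continuous g} ->
  {within A, continuous (fun t => complex.Re '< f t, g t >)}.
Proof. by move=> cf cg x; apply: Re_ip_cvg; [exact: cf|exact: cg]. Qed.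

Lemma blin_within V W (A : set R) (f : V -> W) (g : R -> V) : bounded_linear f ->
  {within A, continuous g} -> {within A, continuous (fun t => f (g t))}.
Proof. by move=> bf cg x; apply: (blin_cvg bf); exact: cg. Qed.

Lemma norm_sq_is_derive H (z z' : R -> H) (t : R) : derivative_on_halfline z z' -> 0 < t ->
  is_derive t 1 (fun t => complex.Re '< z t, z t >) (2 * complex.Re '< z' t, z t >).
Proof.
move=> hz t0.
have cz : z (t + h) @[h --> 0^'] --> z t.
  apply/cvg_rnormP => e e0.
  have [d d0 hd] := derivative_halfline_dist hz (ltW t0) e0.
  (* The bound |h| < t keeps t + h in the half-line, so that the limit is two-sided. *)
  apply/nbhs_normP; exists (Num.min d t) => /=; first by rewrite lt_min d0.
  move=> h; rewrite /= sub0r normrN lt_min => /andP[h1 h2] _; apply: hd => //.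
  by rewrite -lerBlDl sub0r; apply: ltW; move: h2; rewrite ltr_norml => /andP[].
have qz : (h^-1)%:C *: (z (t + h) - z t) @[h --> 0^'] --> z' t.
  apply/cvg_rnormP => e e0.
  have [d d0 hd] := (derivative_on_halflineP _ _).1 hz t (ltW t0) e e0.
  apply/nbhs_normP; exists (Num.min d t) => /=; first by rewrite lt_min d0.
  move=> h; rewrite /= sub0r normrN lt_min => /andP[h1 h2] h0; apply: hd => //.
  by rewrite -lerBlDl sub0r; apply: ltW; move: h2; rewrite ltr_norml => /andP[].
set e := (fun t => _).
have de : (fun h : R => h^-1 *: ((e \o shift t) (h *: 1) - e t)) @ 0^' -->
    2 * complex.Re '< z' t, z t >.
  have -> : 2 * complex.Re '< z' t, z t > =
      complex.Re '< z' t, z t > + complex.Re '< z t, z' t >.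
    by rewrite (ipC (z t) (z' t)) Re_conjc; ring.
  apply: cvg_trans (cvgD (Re_ip_cvg qz cz) (Re_ip_cvg (cvg_cst (z t)) qz)).
  apply: near_eq_cvg; near=> h.
  rewrite /e /shift /= [h%:A]mulr1 (addrC h).
  set q := (h^-1)%:C *: (z (t + h) - z t).
  transitivity (complex.Re '< q, z (t + h) > + complex.Re '< z t, q >); first by [].
  transitivity (h^-1 * (complex.Re '< z (t + h), z (t + h) > - complex.Re '< z t, z t >)); last by [].
  rewrite ipZl ipZr conjc_real -ReD -mulrDr Re_realM -ReB; congr (_ * complex.Re _).
  by rewrite ipBl ipBr addrA subrK.
split; first by apply/cvg_ex; eexists; exact: de.
by rewrite /derive; exact: cvg_lim de.
Unshelve. all: by end_near. Qed.

Lemma halfline_itv (tau : R) : `[0, tau] `<=` [set t | 0 <= t].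
Proof. by move=> t /=; rewrite in_itv /= => /andP[]. Qed.

Lemma within_integrable (f : R -> R) (a b : R) : {within `[a, b], continuous f} ->
  lebesgue_measure.-integrable `[a, b] (EFin \o f).
Proof. by move=> cf; apply: continuous_compact_integrable => //; exact: segment_compact. Qed.

Lemma norm_sq_integral H (z z' : R -> H) (tau : R) : C1_halfline z z' -> 0 < tau ->
  rnorm (z tau) ^+ 2 - rnorm (z 0) ^+ 2 =
  \int[lebesgue_measure]_(t in `[0, tau]) (2 * complex.Re '< z' t, z t >).
Proof.
move=> [dz cz'] tau0; have cz := derivative_halfline_continuous dz.
have sq t : rnorm (z t) ^+ 2 = complex.Re '< z t, z t > by rewrite ip_rnorm.
have cw := continuous_subspaceW (@halfline_itv tau).
rewrite !sq /Rintegral (@continuous_FTC2 _ _ (fun t => complex.Re '< z t, z t >)) //.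
- move=> x; apply: cvgM; first exact: cvg_cst.
  by apply: (cw _ _ _); exact: Re_ip_within.
- have /(continuous_within_itvP _ tau0)[h1 h2 h3] :
    {within `[0, tau], continuous (fun t => complex.Re '< z t, z t >)}.
    by apply: cw; exact: Re_ip_within.
  split => // t; rewrite in_itv /= => /andP[t0 _].
  by have [] := norm_sq_is_derive dz t0.
move=> t; rewrite in_itv /= => /andP[t0 _]; rewrite derive1E.
by have [] := norm_sq_is_derive dz t0.
Qed.

(** Were f 0 < 0, then f <= f 0 / 2 on a short interval, whose integral would be negative. This
    carries out the passage tau -> 0 in the minimality argument. *)
Lemma Rintegral_ge0_germ (f : R -> R) : {within [set t | 0 <= t], continuous f} ->
  (forall tau, 0 < tau -> 0 <= \int[lebesgue_measure]_(t in `[0, tau]) f t) ->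
  0 <= f 0.
Proof.
move=> cf hf; rewrite leNgt; apply/negP => f0.
have /subspace_continuousP/(_ 0 (lexx 0)) := cf.
have f2 : 0 < - f 0 / 2 by rewrite divr_gt0 // oppr_gt0.
move=> /cvgrPdist_lt/(_ _ f2)/nbhs_normP[d /= d0 hd].
pose tau := d / 2; have tau0 : 0 < tau by rewrite divr_gt0.
have := hf tau tau0; apply/negP; rewrite -ltNge.
apply: (@le_lt_trans _ _ (\int[lebesgue_measure]_(t in `[0, tau]) (f 0 / 2))).
  apply: le_Rintegral => //.
  - by apply/within_integrable/(continuous_subspaceW (@halfline_itv tau)).
  - by apply: within_integrable => x; exact: cvg_cst.
  move=> t; rewrite /= in_itv /= => /andP[t0 tt].
  have := hd t; rewrite /= sub0r normrN ger0_norm // => /(_ _ t0) h.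
  have /h : t < d by apply: le_lt_trans tt _; rewrite /tau ltr_pdivrMr // ltr_pMr // ltr1n.
  by rewrite ltr_norml -[X in _ < X < _]/(f 0 - f t) => /andP[h1 _]; lra.
have mE : lebesgue_measure (`[0, tau]%classic : set R) = tau%:E.
  by rewrite lebesgue_measure_itv /= lte_fin tau0 oppr0 adde0.
rewrite Rintegral_cst // [X in fine X]mE /=.
by rewrite nmulr_rlt0 // -oppr_gt0 -mulNr.
Qed.

End Calculus.

(** * Orbits of strongly continuous semigroups *)

Section Semigroups.
Variables (R : realType) (X : hilbertType R) (T : R -> X -> X).
Hypothesis hT : c0_semigroup T.

Lemma semigroup_blin t : 0 <= t -> bounded_linear (T t).
Proof. by case: hT => h _ _ _; exact: h. Qed.

Lemma semigroup0 x : T 0 x = x.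
Proof. by case: hT. Qed.

Lemma semigroupD s t x : 0 <= s -> 0 <= t -> T (s + t) x = T s (T t x).
Proof. by case: hT => _ _ h _; exact: h. Qed.

Lemma semigroup_cvg0 x e : 0 < e -> exists2 d, 0 < d &
  forall t, 0 <= t -> t < d -> rnorm (x - T t x) < e.
Proof.
case: hT => _ T0 _ h e0; have /cvg_rnormP/(_ e e0)/nbhs_normP[d /= d0 hd] := h x.
exists d => // t; rewrite le_eqVlt => /predU1P[<-|t0] td.
  by rewrite T0 subrr rnorm0.
by apply: hd => //=; rewrite sub0r normrN gtr0_norm.
Qed.

(* Gliding hump: if the [T t] were unbounded near 0, then inside any ball there
   would be a smaller one on which some [T t], with [t] as close to 0 as desired,
   exceeds [n]; the common point of a nested sequence of such balls contradicts
   strong continuity at 0. *)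
Lemma semigroup_bounded_near0 : exists2 d, 0 < d & exists M, forall t x,
  0 <= t <= d -> rnorm (T t x) <= M * rnorm x.
Proof.
apply: contrapT => hn.
have unb n : exists t x, 0 <= t <= n.+1%:R^-1 /\ n.+1%:R * rnorm x < rnorm (T t x).
  apply: contrapT => h; apply: hn; exists n.+1%:R^-1; first by rewrite invr_gt0.
  exists n.+1%:R => t x ht; rewrite leNgt; apply/negP => hx.
  by apply: h; exists t, x.
(* Here [yr] is a ball (centre, radius), [p.1] the smaller ball and [p.2] the time. The guard on the
   radius sits inside the existential so that [choice] applies to all pairs. *)
have step (n : nat) (yr : X * R) : exists p : (X * R) * R, 0 < yr.2 ->
  [/\ 0 < p.1.2 <= n.+1%:R^-1, rnorm (yr.1 - p.1.1) + p.1.2 <= yr.2,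
      0 <= p.2 <= n.+1%:R^-1 &
      forall x, rnorm (p.1.1 - x) <= p.1.2 -> n%:R <= rnorm (T p.2 x)].
  case: yr => y r /=; have [r0|] := ltP 0 r; last by move=> h; exists (0, 0, 0).
  have [|m0 hm0] := @exists_invS R (r / 2 / n.+1%:R).
    by rewrite !divr_gt0.
  (* From m0 on, (m + 1) r / 2 exceeds n + 1, so x rescaled to norm r / 2 is sent to norm at least n
     + 1; m >= n keeps t below 1 / (n + 1). *)
  pose m := maxn m0 n; have [t [x [/andP[t0 tm] hx]]] := unb m.
  have bT := semigroup_blin t0; have lT := bT.1.
  have /bounded_linearP[_ [M M0 hM]] := bT.
  have xn : 0 < rnorm x.
    rewrite lt_neqAle rnorm_ge0 andbT eq_sym; apply/eqP => e; move: hx.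
    by rewrite (rnorm_le0 (x := x)) ?e // (lin0 lT) !rnorm0 mulr0 ltxx.
  pose x1 := (r / 2 / rnorm x)%:C *: x.
  have nx1 : rnorm x1 = r / 2.
    by rewrite /x1 rnormZr ger0_norm ?divfK ?gt_eqF // ?divr_ge0 ?ltW.
  have hx1 : n.+1%:R <= rnorm (T t x1).
    rewrite /x1 (linZ lT) rnormZr ger0_norm; last by rewrite !divr_ge0 ?ltW.
    apply: (@le_trans _ _ (r / 2 / rnorm x * (m.+1%:R * rnorm x))); last first.
      by rewrite ler_wpM2l ?(ltW hx) // !divr_ge0 ?ltW.
    rewrite [X in _ <= _ * X]mulrC mulrA divfK ?gt_eqF //.
    have : m.+1%:R^-1 < r / 2 / n.+1%:R by apply: hm0; rewrite leq_maxl.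
    rewrite ltr_pdivlMr // mulrC ltr_pdivrMr //; exact: ltW.
  (* One of y + x1 and y - x1 works, since their images differ by 2 T t x1. *)
  have [y' [ny' hy']] : exists y', rnorm (y - y') = r / 2 /\ n.+1%:R <= rnorm (T t y').
    have h : 2 * rnorm (T t x1) <= rnorm (T t (y + x1)) + rnorm (T t (y - x1)).
      apply: le_trans (rnormB _ _); rewrite -(linB lT) opprD opprK addrACA subrr add0r.
      by rewrite (linD lT) rnorm_double.
    have [h1|h1] := leP n.+1%:R (rnorm (T t (y + x1))).
      by exists (y + x1); split=> //; rewrite opprD addrA subrr add0r rnormN.
    exists (y - x1); split; first by rewrite opprB addrC subrK.
    by move: h h1 hx1; lra.
  have M1 : 0 < M + 1 by rewrite ltr_wpDl.
  (* The three terms keep the new ball inside the old one, let T t vary by at most 1 on it (hence n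
     + 1 drops to n), and make the radii tend to 0. *)
  pose r' := Num.min (Num.min (r / 2) (M + 1)^-1) n.+1%:R^-1.
  have r'1 : r' <= r / 2 by rewrite /r' !ge_min lexx.
  have r'2 : r' <= (M + 1)^-1 by rewrite /r' !ge_min lexx orbT.
  have r'3 : r' <= n.+1%:R^-1 by rewrite /r' !ge_min lexx orbT.
  have r'0 : 0 < r' by rewrite /r' !lt_min !divr_gt0 // !invr_gt0 M1 ltr0Sn.
  exists (y', r', t) => _ /=; split.
  - by rewrite r'0.
  - by rewrite ny'; lra.
  - rewrite t0 (le_trans tm) // lef_pV2 ?posrE // ler_nat ltnS.
    exact: leq_maxr.
  move=> z hz.
  have h1 : rnorm (T t (y' - z)) <= 1.
    apply: le_trans (hM _) _; apply: (@le_trans _ _ ((M + 1) * rnorm (y' - z))).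
      by rewrite ler_wpM2r ?rnorm_ge0 // lerDl.
    by rewrite mulrC -ler_pdivlMr // div1r (le_trans hz).
  have h2 : rnorm (T t y') <= rnorm (T t (y' - z)) + rnorm (T t z).
    by rewrite (linB lT); apply: le_trans (rnormD _ _); rewrite subrK.
  by move: hy'; rewrite -natr1; lra.
have [f hf] : exists f : nat -> X * R -> (X * R) * R, forall n yr, 0 < yr.2 ->
  [/\ 0 < (f n yr).1.2 <= n.+1%:R^-1, rnorm (yr.1 - (f n yr).1.1) + (f n yr).1.2 <= yr.2,
      0 <= (f n yr).2 <= n.+1%:R^-1 &
      forall x, rnorm ((f n yr).1.1 - x) <= (f n yr).1.2 -> n%:R <= rnorm (T (f n yr).2 x)].
  have /choice[f hf] : forall nyr : nat * (X * R), exists p : (X * R) * R,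
    0 < nyr.2.2 -> [/\ 0 < p.1.2 <= nyr.1.+1%:R^-1,
      rnorm (nyr.2.1 - p.1.1) + p.1.2 <= nyr.2.2, 0 <= p.2 <= nyr.1.+1%:R^-1 &
      forall x, rnorm (p.1.1 - x) <= p.1.2 -> nyr.1%:R <= rnorm (T p.2 x)].
    by move=> [n yr]; exact: step.
  by exists (fun n yr => f (n, yr)) => n yr; exact: (hf (n, yr)).
pose b := fix b n := if n is k.+1 then (f k (b k)).1 else ((0 : X), (1 : R)).
have b0 n : 0 < (b n).2.
  elim: n => [|n IH]; first exact: ltr01.
  by have [/andP[]] := hf n _ IH.
have bstep n := hf n _ (b0 n).
have bmono n k : rnorm ((b n).1 - (b (n + k)%N).1) + (b (n + k)%N).2 <= (b n).2.
  elim: k => [|k IH]; first by rewrite addn0 subrr rnorm0 add0r.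
  have [_ h _ _] := bstep (n + k)%N; rewrite addnS.
  have h2 : rnorm ((b n).1 - (b (n + k).+1).1) <=
    rnorm ((b n).1 - (b (n + k)%N).1) + rnorm ((b (n + k)%N).1 - (b (n + k).+1).1).
    by apply: le_trans (rnormD _ _); rewrite addrA subrK.
  by move: h h2 IH => /=; lra.
have bdist n m : (n <= m)%N -> rnorm ((b n).1 - (b m).1) <= (b n).2.
  move=> /subnKC <-; have := bmono n (m - n)%N; have := b0 (n + (m - n))%N; lra.
have bsmall n : (b n.+1).2 <= n.+1%:R^-1.
  by have [/andP[_ h] _ _ _] := bstep n.
have [y hy] : exists y : X, (b n).1 @[n --> \oo] --> y.
  apply: (@rnorm_complete R X (fun n => (b n).1)) => e e0.
  have [N hN] := exists_invS (divr_gt0 e0 (@ltr0Sn R 1)).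
  exists N.+1 => m n Nm Nn.
  have h1 := bdist _ _ Nm; have h2 := bdist _ _ Nn.
  have h3 : rnorm ((b m).1 - (b n).1) <=
    rnorm ((b N.+1).1 - (b m).1) + rnorm ((b N.+1).1 - (b n).1).
    have -> : (b m).1 - (b n).1 = (b N.+1).1 - (b n).1 - ((b N.+1).1 - (b m).1).
      by rewrite opprB [RHS]addrC addrA subrK.
    by apply: le_trans (rnormB _ _) _; rewrite addrC.
  have h4 := le_lt_trans (bsmall N) (hN _ (leqnn _)).
  by move: h1 h2 h3 h4; lra.
have hball n : rnorm ((b n).1 - y) <= (b n).2.
  apply/ler_addgt0Pl => e e0; have /cvg_rnormP/(_ e e0)[N _ hN] := hy.
  have := hN (maxn n N) (leq_maxr _ _); have := bdist n (maxn n N) (leq_maxl _ _).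
  have : rnorm ((b n).1 - y) <= rnorm ((b n).1 - (b (maxn n N)).1) + rnorm (y - (b (maxn n N)).1).
    by rewrite (rnormBC y); apply: le_trans (rnormD _ _); rewrite addrA subrK.
  by lra.
have [d d0 hd] := semigroup_cvg0 y ltr01.
have [N hN] := exists_invS d0.
(* Large enough that the time is below d, where |T t y| < |y| + 1, while the common point y
   satisfies |T t y| >= n > |y| + 1. *)
pose n := maxn N (Num.truncn (rnorm y + 1)).+1.
have [_ _ /andP[t0 tn] /(_ y (hball n.+1))] := bstep n.
set t := _.2 in t0 tn *; have td : t < d.
  by apply: le_lt_trans tn (hN _ _); rewrite leq_maxl.
have h1 := hd t t0 td.
have h2 : rnorm (T t y) <= rnorm (y - T t y) + rnorm y.
  by rewrite rnormBC; apply: le_trans (rnormD _ _); rewrite subrK.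
have h3 : rnorm y + 1 < n%:R.
  apply: lt_le_trans (truncnS_gt _) _; rewrite ler_nat; exact: leq_maxr.
by apply/negP; rewrite -ltNge; lra.
Qed.

Lemma semigroup_bounded_on tau : exists2 M, 0 <= M & forall t x, 0 <= t <= tau ->
  rnorm (T t x) <= M * rnorm x.
Proof.
have [d d0 [M hM]] := semigroup_bounded_near0.
(* L >= 1 makes the powers of L nondecreasing, so L^(n+1) covers all times up to n d, reached in
   steps of length d. *)
pose L := Num.max M 1; have L1 : 1 <= L by rewrite /L le_max lexx orbT.
have L0 : 0 <= L by apply: le_trans L1.
have hL t x : 0 <= t <= d -> rnorm (T t x) <= L * rnorm x.
  move=> /(hM t x)/le_trans; apply; rewrite ler_wpM2r ?rnorm_ge0 //.
  by rewrite /L le_max lexx.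
have key n : forall t x, 0 <= t <= n%:R * d -> rnorm (T t x) <= L ^+ n.+1 * rnorm x.
  elim: n => [|n IH] t x.
    rewrite mul0r => /andP[h1 h2]; rewrite expr1; apply: hL.
    by rewrite h1 (le_trans h2) // ltW.
  move=> /andP[t0 tn]; have [td|dt] := leP t d.
    apply: le_trans (hL t x _) _; first by rewrite t0.
    rewrite ler_wpM2r ?rnorm_ge0 // exprS ler_peMr // exprn_ege1 //.
  have -> : t = d + (t - d) by rewrite addrC subrK.
  rewrite semigroupD ?(ltW d0) ?subr_ge0 ?(ltW dt) //.
  apply: le_trans (hL _ _ _) _; first by rewrite lexx ltW.
  rewrite exprS -mulrA ler_wpM2l //; apply: IH.
  by rewrite subr_ge0 (ltW dt) /= lerBlDr; move: tn; rewrite -natr1 mulrDl mul1r.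
pose n := (Num.truncn (tau / d)).+1.
exists (L ^+ n.+1) => [|t x /andP[t0 tt]]; first exact: exprn_ge0.
apply: key; rewrite t0 (le_trans tt) // -ler_pdivrMr //.
by apply/ltW; exact: truncnS_gt.
Qed.

(** T s x - T (s + k) x = T s (x - T k x). On the left of t the factor T s varies with k, hence the
    bound uniform on [0, t]. *)
Lemma semigroup_continuous x : {within [set t | 0 <= t], continuous (fun t => T t x)}.
Proof.
apply/subspace_continuousP => t /= t0; apply/cvg_rnormP => e e0.
have [M M0 hM] := semigroup_bounded_on t.
have [Mt Mt0 hMt] : exists2 Mt, 0 <= Mt & forall x, rnorm (T t x) <= Mt * rnorm x.
  by have /bounded_linearP[_ ] := semigroup_blin t0.
have M1 : 0 < M + 1 by rewrite ltr_wpDl.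
have [d d0 hd] := semigroup_cvg0 x (divr_gt0 e0 M1).
have step s k : 0 <= s <= t -> 0 <= k < d -> rnorm (T s x - T (s + k) x) < e.
  move=> /andP[s0 st] /andP[k0 kd]; rewrite semigroupD // -(linB (semigroup_blin s0).1).
  apply: le_lt_trans (hM _ _ _) _; first by rewrite s0.
  apply: (@le_lt_trans _ _ ((M + 1) * rnorm (x - T k x))).
    by rewrite ler_wpM2r ?rnorm_ge0 // lerDl.
  by rewrite mulrC -ltr_pdivlMr //; exact: hd.
apply/nbhs_normP; exists d => //= s; rewrite /= => ts s0.
have [le_ts|lt_st] := leP t s.
  have -> : s = t + (s - t) by rewrite addrC subrK.
  apply: step; first by rewrite t0 lexx.
  by rewrite subr_ge0 le_ts /= -(ger0_norm (_ : 0 <= s - t)) ?subr_ge0 // distrC.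
have tE : t = s + (t - s) by rewrite addrC subrK.
rewrite rnormBC {1}tE; apply: step; first by rewrite s0 ltW.
by rewrite subr_ge0 ltW //= -(ger0_norm (_ : 0 <= t - s)) // subr_ge0 ltW.
Qed.

(** Only the right derivative at 0 is given. T t transports it to the right of t; on the left, with
    t = s + k, the quotient is T s ((T k w - w) / k), and T s is controlled uniformly. *)
Lemma orbit_C1 w w' : (t^-1)%:C *: (T t w - w) @[t --> 0^'+] --> w' ->
  C1_halfline (fun t => T t w) (fun t => T t w').
Proof.
move=> hw; split; last exact: semigroup_continuous.
apply/derivative_on_halflineP => t t0 e e0.
have [M M0 hM] := semigroup_bounded_on t.
have M1 : 0 < M + 1 by rewrite ltr_wpDl.
have e2 : 0 < e / 2 / (M + 1) by rewrite !divr_gt0.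
have [d1 d10 hd1] := semigroup_cvg0 w' e2.
have /cvg_rnormP/(_ _ e2)/nbhs_normP[d2 /= d20 hd2] := hw.
have quo k : 0 < k -> k < d2 -> rnorm (w' - (k^-1)%:C *: (T k w - w)) < e / 2 / (M + 1).
  by move=> k0 kd; apply: hd2 => //=; rewrite sub0r normrN gtr0_norm.
have bd s x : 0 <= s <= t -> rnorm x < e / (M + 1) -> rnorm (T s x) < e.
  move=> hs hx; apply: le_lt_trans (hM _ _ hs) _.
  apply: (@le_lt_trans _ _ ((M + 1) * rnorm x)).
    by rewrite ler_wpM2r ?rnorm_ge0 // lerDl.
  by rewrite mulrC -ltr_pdivlMr.
exists (Num.min d1 d2); first by rewrite lt_min d10.
move=> h h0; rewrite lt_min => /andP[hd1' hd2'] th.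
have [hpos|hneg] := ltP 0 h.
  have lT := (semigroup_blin t0).1.
  rewrite semigroupD ?(ltW hpos) // -(linB lT) -(linZ lT) -(linB lT).
  apply: bd; first by rewrite t0 lexx.
  apply: lt_trans (quo h hpos _) _; first by rewrite -(gtr0_norm hpos).
  by rewrite ltr_pM2r ?invr_gt0 // ltr_pdivrMr // ltr_pMr // ltr1n.
have k0 : 0 < - h by rewrite oppr_gt0 lt_neqAle h0.
have kn : `|h| = - h by rewrite ler0_norm.
have [k hE] : exists k, h = - k by exists (- h); rewrite opprK.
have kE : k = - h by rewrite hE opprK.
have [s sE] : exists s, t + h = s by exists (t + h).
have tE : t = s + k by rewrite -sE kE addrK.
rewrite -kE in k0 kn; rewrite sE in th *.
have lT := (semigroup_blin th).1.
have -> : h^-1 = - k^-1 by rewrite hE invrN.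
rewrite {1 2}tE !(semigroupD _ th) ?(ltW k0) //.
have -> : (- k^-1)%:C *: (T s w - T s (T k w)) = T s ((k^-1)%:C *: (T k w - w)).
  by rewrite (linZ lT) (linB lT) rcN scaleNr -scalerN opprB.
rewrite -(linB lT); apply: bd; first by rewrite th -sE gerDl.
(* The limit on the left is T s (T k w'), not T s w': the error splits into that of the quotient and
   w' - T k w', each below half of e / (M + 1). *)
have -> : T k w' - (k^-1)%:C *: (T k w - w) =
  (w' - (k^-1)%:C *: (T k w - w)) - (w' - T k w').
  by rewrite opprB [RHS]addrC addrA subrK.
apply: le_lt_trans (rnormB _ _) _.
have kd2 : k < d2 by rewrite -kn.
have h1 := quo k k0 kd2.
have h2 : rnorm (w' - T k w') < e / 2 / (M + 1).
  by apply: hd1; [exact: ltW|rewrite -kn].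
have -> : e / (M + 1) = e / 2 / (M + 1) + e / 2 / (M + 1) by rewrite -mulrDl -splitr.
exact: ltrD.
Qed.

End Semigroups.

(** * The scalar exponential e^{st} *)

Section ComplexExponential.
Variable R : realType.

Definition cexp (s : R[i]) (t : R) : R[i] :=
  let r := expR (complex.Re s * t) in let b := complex.Im s * t in
  (r * cos b) +i* (r * sin b).

Lemma cexp0 s : cexp s 0 = 1.
Proof. by rewrite /cexp !mulr0 expR0 cos0 sin0 !mul1r. Qed.

Lemma is_derive_diffquo (f : R -> R) (t d : R) : is_derive t 1 f d ->
  forall e, 0 < e -> exists2 r, 0 < r &
    forall h, h != 0 -> `|h| < r -> `|d - h^-1 * (f (t + h) - f t)| < e.
Proof.
move=> [df <-] e e0; have /cvgrPdist_lt/(_ e e0)/nbhs_normP[r /= r0 hr] := df.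
exists r => // h h0 hr'; have := hr h; rewrite /= sub0r normrN => /(_ hr' h0).
by rewrite /shift /= [h%:A]mulr1 (addrC h).
Qed.

Lemma cabs_le_ReIm (z : R[i]) : cabs z <= `|complex.Re z| + `|complex.Im z|.
Proof.
rewrite -lecR -cabsE {1}[z]complexE rcD; apply: le_trans (ler_normD _ _) _.
rewrite normrM !cabsE !cabs_real.
have -> : cabs ('i%C : R[i]) = 1.
  by rewrite /cabs normc_def /= expr0n expr1n add0r sqrtr1.
by rewrite mul1r.
Qed.

Lemma cexp_derivative s (t : R) e : 0 < e -> exists2 d, 0 < d &
  forall h, h != 0 -> `|h| < d ->
    cabs (s * cexp s t - (h^-1)%:C * (cexp s (t + h) - cexp s t)) < e.
Proof.
move=> e0; case: s => a b.
have lin c : is_derive t 1 (fun t : R => c * t) c.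
  by apply: is_derive_eq; rewrite /GRing.scale /= mulr1.
have dx : is_derive t 1 (expR \o (fun t => a * t)) (expR (a * t) * a).
  by apply: is_derive1_comp.
have dc : is_derive t 1 (cos \o (fun t => b * t)) (- sin (b * t) * b).
  by apply: is_derive1_comp.
have ds : is_derive t 1 (sin \o (fun t => b * t)) (cos (b * t) * b).
  by apply: is_derive1_comp.
have e2 : 0 < e / 2 by rewrite divr_gt0.
have [d1 d10 hd1] := is_derive_diffquo (is_deriveM dx dc) e2.
have [d2 d20 hd2] := is_derive_diffquo (is_deriveM dx ds) e2.
exists (Num.min d1 d2); first by rewrite lt_min d10.
move=> h h0; rewrite lt_min => /andP[h1 h2].
apply: le_lt_trans (cabs_le_ReIm _) _; rewrite [e]splitr.
have PE (f g : R -> R) x : (f * g) x = f x * g x by [].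
have {}hd1 := hd1 h h0 h1; have {}hd2 := hd2 h h0 h2.
apply: ltrD.
  apply: le_lt_trans hd1; rewrite le_eqVlt; apply/orP; left; apply/eqP.
  rewrite /cexp /= !mul0r subr0; congr (`| _ |).
  by rewrite /GRing.scale /= !PE /=; ring.
apply: le_lt_trans hd2; rewrite le_eqVlt; apply/orP; left; apply/eqP.
rewrite /cexp /= !mul0r addr0; congr (`| _ |).
by rewrite /GRing.scale /= !PE /=; ring.
Qed.

Lemma cexp_derivative_on_halfline (V : normedModType R[i]) s (v : V) :
  derivative_on_halfline (fun t => cexp s t *: v) (fun t => cexp s t *: (s *: v)).
Proof.
apply/derivative_on_halflineP => t t0 e e0.
have v1 : 0 < rnorm v + 1 by rewrite ltr_wpDl ?rnorm_ge0.
have [d d0 hd] := cexp_derivative s t (divr_gt0 e0 v1).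
exists d => // h h0 hd' _; have {}hd := hd h h0 hd'.
rewrite -scalerBl !scalerA -scalerBl (mulrC _ s) rnormZ.
apply: (@le_lt_trans _ _ (cabs (s * cexp s t - (h^-1)%:C * (cexp s (t + h) - cexp s t)) * (rnorm v + 1))).
  by rewrite ler_wpM2l ?cabs_ge0 // lerDl.
by rewrite -ltr_pdivlMr.
Qed.

Lemma derivative_on_halflineD (V : normedModType R[i]) (f g f' g' : R -> V) :
  derivative_on_halfline f f' -> derivative_on_halfline g g' ->
  derivative_on_halfline (fun t => f t + g t) (fun t => f' t + g' t).
Proof.
move=> hf hg t t0; apply: cvg_trans (cvgD (hf t t0) (hg t t0)).
apply: near_eq_cvg; near=> h.
transitivity ((h^-1)%:C *: (f (t + h) - f t) + (h^-1)%:C *: (g (t + h) - g t)); first by [].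
by rewrite -scalerDr opprD addrACA.
Unshelve. all: by end_near. Qed.

End ComplexExponential.

Arguments cexp_derivative_on_halfline {R V} s v.

(** * Energy balance, passivity and minimality *)

Section Passivity.
Variables (R : realType) (U X : hilbertType R) (S : node_data U X U) (Q : X -> X).
Hypotheses (hS : system_node S) (hA : skew_dissipative S Q) (hC : colocated S).
Let A := node_A S.
Let ra := node_rho_alpha hS.
Let dA := node_dense hS.
Let bQ := node_Q_blin hA.

Lemma colocated_system_node (F : U -> U) : bounded_linear F ->
  system_node (colocated_node S F).
Proof.
move=> bF; have [gen bB [linC [M hM]] [bG hG]] := hS; split=> //.
- split.
    move=> a x x' Dx Dx' /=; rewrite -!hC //; first exact: linC.
    by have [] := op_linear ra a Dx Dx'.
  by exists M => x Dx /=; rewrite -hC //; exact: hM.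
- split=> [s rs|s b rs rb v] /=; first exact: (blin_add (bG s rs) bF).
  (* F cancels in the difference, and (s I - A)^-1 B v - (b I - A)^-1 B v lies in D(A), where C and
     B^* agree. *)
  rewrite opprD addrACA subrr addr0 hG // hC //; exact: resB_diff_dom.
Qed.

Section Trajectory.
Variables (u : R -> U) (z z' : R -> X) (F : U -> U) (s : R[i]).
Hypothesis rs : rho S s.
Hypothesis zE : forall t, 0 <= t ->
  ext_inj (node_Xm1 S) (z' t) = op_extension (node_Xm1 S) (z t) + node_B S (u t).

(** In X_{-1} the equation reads (s I - A) z = (s z - z') + B u with s z - z' in X. Applying the
    extended resolvent gives w = R_s (s z - z'), which is in D(A). *)
Lemma trajectory_decomp t : 0 <= t -> exists w, [/\ dom A w,
  z t = w + resB S s (u t) & z' t = A w + s *: resB S s (u t)].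
Proof.
move=> t0; pose w := resolvent A s (s *: z t - z' t).
have zw : z t = w + resB S s (u t).
  rewrite -[LHS](resolvent_ext_op (node_Xm1 S) ra dA rs).
  have -> : op_extension (node_Xm1 S) (z t) =
      ext_inj (node_Xm1 S) (z' t) - node_B S (u t) by rewrite zE // addrK.
  have lj := ext_inj_linear (node_Xm1 S).
  have lR := (resolvent_ext_blin (node_Xm1 S) ra rs).1.
  rewrite opprB addrCA addrC -(linZ lj) -(linB lj) (linD lR).
  by rewrite (resolvent_extE _ ra rs).
exists w; split=> //; first exact: resolvent_dom.
by rewrite (op_resolvent rs) -/w addrAC -scalerDr -zw subKr.
Qed.

Let y := node_output (colocated_node S F) s u z.

Lemma output_balance t : 0 <= t ->
  complex.Re '< u t, y t > = complex.Re '< z' t, z t >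
    + 2^-1 * (complex.Re '< Q (z t), z t >
              + 2 * complex.Re '< u t, F (u t) - E_op S Q s (u t) >).
Proof.
move=> t0; have [w [Dw hz hz']] := trajectory_decomp t0.
have := power_balance hS hA (u t) rs Dw; rewrite -/A -hz -hz'.
have -> : y t = node_Bstar S w + (node_G S s (u t) + F (u t)).
  by rewrite /y /node_output hz addrK.
move: (E_op S Q s (u t)) => e.
by rewrite /= !(ipDr (u t)) ipNr !ReD ReN => h; lra.
Qed.

End Trajectory.

(** Kept general in F because it serves twice: F = E removes the last term and yields passivity,
    while for a competitor that term carries the comparison. *)
Lemma energy_balance (F : U -> U) (s : R[i]) (u u' : R -> U) (z z' : R -> X) (tau : R) :
  rho S s -> bounded_linear F -> derivative_on_halfline u u' -> C1_halfline z z' ->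
  (forall t, 0 <= t -> ext_inj (node_Xm1 S) (z' t)
     = op_extension (node_Xm1 S) (z t) + node_B S (u t)) ->
  0 < tau ->
  2 * \int[lebesgue_measure]_(t in `[0, tau])
    complex.Re '< u t, node_output (colocated_node S F) s u z t > =
  rnorm (z tau) ^+ 2 - rnorm (z 0) ^+ 2 +
  \int[lebesgue_measure]_(t in `[0, tau])
    (complex.Re '< Q (z t), z t > +
     2 * complex.Re '< u t, F (u t) - E_op S Q s (u t) >).
Proof.
move=> rs bF du C1 zE tau0; rewrite (norm_sq_integral C1 tau0).
have [dz cz'] := C1; have cz := derivative_halfline_continuous dz.
have cu := derivative_halfline_continuous du.
have bE := E_op_blin hS hA rs.
have cw := continuous_subspaceW (@halfline_itv R tau).
pose f t := complex.Re '< z' t, z t >.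
pose g t := complex.Re '< Q (z t), z t > +
  2 * complex.Re '< u t, F (u t) - E_op S Q s (u t) >.
have cf : {within [set t | 0 <= t], continuous f} by exact: Re_ip_within.
have cg : {within [set t | 0 <= t], continuous g}.
  move=> t; apply: cvgD; first by apply: Re_ip_within => //; exact: blin_within.
  apply: cvgM; first exact: cvg_cst.
  apply: Re_ip_within => //.
  exact: (blin_within (blin_add bF (blin_opp bE)) cu).
have int_ (h : R -> R) : {within [set t | 0 <= t], continuous h} ->
    lebesgue_measure.-integrable `[0, tau] (EFin \o h).
  by move=> ch; apply: within_integrable; exact: cw.
have cM (c : R) (h : R -> R) : {within [set t | 0 <= t], continuous h} ->
    {within [set t | 0 <= t], continuous (fun t => c * h t)}.
  by move=> ch t; apply: cvgM; [exact: cvg_cst|exact: ch].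
rewrite -[X in _ = _ + X]/(\int[lebesgue_measure]_(t in `[0, tau]) g t).
rewrite -RintegralD //; [|exact/int_/cM|exact: int_].
have -> : \int[lebesgue_measure]_(t in `[0, tau])
      complex.Re '< u t, node_output (colocated_node S F) s u z t > =
    \int[lebesgue_measure]_(t in `[0, tau]) (f t + 2^-1 * g t).
  apply: eq_Rintegral => t; rewrite inE /= in_itv /= => /andP[t0 _].
  exact: output_balance.
rewrite -RintegralZl //; last first.
  by apply: int_ => t; apply: cvgD; [exact: cf|exact: cM].
by apply: eq_Rintegral => t _; rewrite /f; field.
Qed.

Lemma E_op_passive s : rho S s -> impedance_passive (colocated_node S (E_op S Q s)).
Proof.
move=> rs z0 u z [[u' [u'' [du _]]] _] [<- [z' C1 zE]] b rb tau tau0.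
(* The output is computed at b, and the balance involves E at that same point. *)
have -> : E_op S Q s = E_op S Q b.
  by apply/funext => v; exact: E_op_indep.
rewrite (energy_balance rb (E_op_blin hS hA rb) du C1 zE tau0).
rewrite !rnormE -!rmorphXn -rmorphB lecR lerDl; apply: Rintegral_ge0 => t _.
rewrite subrr ip0r /= mulr0 addr0 (Q_sym hA).
by have [_ _ /(_ (z t)) h _] := hA; rewrite -(Q_sym hA); exact: (Re_le h).
Qed.

(** Since B v = s K v - A K v in X_{-1}, e^{st} K v solves the driven equation; T(t) w solves the
    homogeneous one and is C^1 because w is in D(A). *)
Lemma exponential_trajectory s v w : rho S s -> dom A w ->
  let u t := cexp s t *: v in
  exists z z', [/\ z 0 = resB S s v + w, C1_halfline z z',
    C2_halfline u, derivative_on_halfline u (fun t => cexp s t *: (s *: v)) &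
    forall t, 0 <= t -> ext_inj (node_Xm1 S) (z' t)
      = op_extension (node_Xm1 S) (z t) + node_B S (u t)].
Proof.
move=> rs Dw u; have [[[T hT gA] _] bB _ _] := hS.
have du := cexp_derivative_on_halfline s v.
exists (fun t => cexp s t *: resB S s v + T t w).
exists (fun t => cexp s t *: (s *: resB S s v) + T t (A w)).
have [oT cT] := orbit_C1 hT ((gA w (A w)).1 (conj Dw erefl)).
split=> //.
- by rewrite cexp0 scale1r (semigroup0 hT).
- split; first exact: derivative_on_halflineD (cexp_derivative_on_halfline _ _) oT.
  have c1 := derivative_halfline_continuous (cexp_derivative_on_halfline s (s *: resB S s v)).
  by move=> t; apply: cvgD; [exact: c1|exact: cT].
- exists (fun t => cexp s t *: (s *: v)), (fun t => cexp s t *: (s *: (s *: v))).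
  split=> //; split; first exact: cexp_derivative_on_halfline.
  exact: derivative_halfline_continuous (cexp_derivative_on_halfline s _).
move=> t t0; have [D e] := generator_semigroup hT gA t0 Dw.
have [bAe hAe] := op_ext_spec (node_Xm1 S) ra dA.
have lA := bAe.1; have lj := ext_inj_linear (node_Xm1 S).
rewrite (linD lj) (linD lA) !(linZ lA) !(linZ lj) (hAe _ D) e.
rewrite /u (linZ bB.1) addrAC; congr (_ + _); rewrite -scalerDr; congr (_ *: _).
have := op_resolvent_ext ra dA rs (node_B S v); rewrite -/(resB S s v) => h.
by rewrite -h addrC subrK.
Qed.

Lemma E_op_least s (F : U -> U) : rho S s -> self_adjoint F ->
  impedance_passive (colocated_node S F) -> op_le (E_op S Q s) F.
Proof.
move=> rs [bF Fsa] hF v; have bE := E_op_blin hS hA rs.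
have Fsym a b : '< F a, b > = '< a, F b > by rewrite adjP // -Fsa.
have real : ('< F v - E_op S Q s v, v >)^*%C = '< F v - E_op S Q s v, v >.
  by rewrite -ipC ipBl ipBr Fsym (E_op_sym hS hA).
suff h : 0 <= complex.Re ('< v, F v - E_op S Q s v >).
  rewrite ipC in real *; move: real h; case: ('< v, _ >) => p q [] /= e h.
  by rewrite lecE /= h andbT; apply/eqP; lra.
set q := complex.Re _.
have key w : dom A w -> 0 <= complex.Re '< Q (resB S s v + w), resB S s v + w > + 2 * q.
  move=> Dw; have [z [z' [z0 C1 C2 du zE]]] := exponential_trajectory v rs Dw.
  set u := (fun t => _) in C2 du zE.
  have u0 : u 0 = v by rewrite /u cexp0 scale1r.
  have cz := derivative_halfline_continuous C1.1.
  have cu := derivative_halfline_continuous du.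
  have := @Rintegral_ge0_germ R (fun t => complex.Re '< Q (z t), z t > +
    2 * complex.Re '< u t, F (u t) - E_op S Q s (u t) >).
  rewrite u0 z0; apply.
    move=> t; apply: cvgD; first by apply: Re_ip_within => //; exact: blin_within.
    apply: cvgM; first exact: cvg_cst.
    apply: Re_ip_within => //.
    exact: (blin_within (blin_add bF (blin_opp bE)) cu).
  move=> tau tau0; have D : D0 (colocated_node S F) (z 0) u.
    split=> //; exists (z' 0) => //=; by rewrite zE.
  have tr : state_trajectory (colocated_node S F) (z 0) u z by split=> //; exists z'.
  have := hF _ _ _ D tr s rs tau tau0.
  rewrite (energy_balance rs bF du C1 zE tau0).
  by rewrite !rnormE -!rmorphXn -rmorphB lecR lerDl.
have /bounded_linearP[_ [M M0 hM]] := bQ.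
have small e : 0 < e -> 0 <= M * e ^+ 2 + 2 * q.
  (* K v need not lie in D(A); w only approximates - K v, leaving an initial state of norm below
     e. *)
  move=> e0; have [w Dw hw] := dense_rnorm dA (- resB S s v) e0.
  have {}hw : rnorm (resB S s v + w) < e by rewrite -rnormN opprD.
  apply: le_trans (key w Dw) _; rewrite lerD2r; apply: le_trans (Re_ip_le _ _) _.
  apply: (@le_trans _ _ (M * rnorm (resB S s v + w) ^+ 2)).
    by rewrite expr2 mulrA ler_wpM2r ?rnorm_ge0.
  by rewrite ler_wpM2l // ler_pXn2r ?nnegrE ?rnorm_ge0 // ltW.
rewrite leNgt; apply/negP => q0.
have M1 : 0 < M + 1 by rewrite ltr_wpDl.
(* Then M e^2 <= (M + 1) e <= - q, so M e^2 + 2 q <= q < 0, against [small]. *)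
pose e := Num.min 1 (- q / (M + 1)).
have e0 : 0 < e by rewrite lt_min ltr01 divr_gt0 // oppr_gt0.
have e1 : e <= 1 by rewrite /e ge_min lexx.
have e2 : e * (M + 1) <= - q by rewrite -ler_pdivlMr // /e ge_min lexx orbT.
have := small e e0; have : M * e ^+ 2 <= e * (M + 1); last by lra.
rewrite expr2 mulrA -[M * e]mulrC; apply: le_trans (ler_piMr _ e1) _.
  by rewrite mulr_ge0 // ltW.
by rewrite ler_wpM2l ?lerDl // ltW.
Qed.

End Passivity.

Theorem theorem3p17 (R : realType) (U X : hilbertType R)
    (S : node_data U X U) (Q : X -> X)
    (hS : system_node S)
    (hA : skew_dissipative S Q)
    (hC : colocated S) :
  (forall s s', rho S s -> rho S s' ->
     forall v, E_op S Q s v = E_op S Q s' v) /\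
  (forall s, rho S s ->
     let E := E_op S Q s in
     [/\ self_adjoint E,
         system_node (colocated_node S E) /\
         impedance_passive (colocated_node S E)
       & forall F : U -> U, self_adjoint F ->
           system_node (colocated_node S F) ->
           impedance_passive (colocated_node S F) ->
           op_le E F]).
Proof.
split=> [s s' rs rs' v|s rs E]; first exact: E_op_indep.
have bE := E_op_blin hS hA rs; split.
- exact: E_op_self_adjoint.
- by split; [exact: colocated_system_node|exact: E_op_passive].
- by move=> F sF _ pF; exact: E_op_least.
Qed.
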